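(* Consider a Lattice Spring Model with data $d,n,m,q,Q,\xi_0,R,r,f$ and $k_i>0$, $h_i\in\mathbb{R}$, $s_i\ge 0$, $c_{0,i}>0$ ($i=1,\dots,m$), and the associated objects $D,K,H,\mathrm{C},F_1,\mathcal{U},\mathcal{V},U,V,P_U,P_V,R^+,G,F$, all as defined in the context. Assume: (1) $\operatorname{rank}R=q$; (2) $\operatorname{Ker}D\cap\operatorname{Ker}R=\{0\}$ (equivalently $\operatorname{rank}\begin{pmatrix}D^\top & R^\top\end{pmatrix}=nd$); (3) $r:[0,T]\to\mathbb{R}^q$ and $f:[0,T]\to\mathbb{R}^{nd}$ are absolutely continuous; (4) $nd-q<m$. Suppose $s_i>0$ for all $i\in\{1,\dots,m\}$. Then the following two statements about functions $x,\varepsilon,p,\sigma,a,y:[0,T]\to\mathbb{R}^m$ and $\zeta:[0,T]\to\mathbb{R}^{nd}$ are equivalent. (i) $x,\varepsilon,p,\sigma,a,\zeta$ are absolutely continuous and solve the lattice problem: for all $t\in[0,T]$ $$x=\varepsilon+p,\qquad \sigma=K\varepsilon,\qquad D\zeta=x,\qquad R(\xi_0+\zeta)+r(t)=0,\qquad D^\top(-\sigma+F_1f(t))\in\operatorname{Im}R^\top,$$ and for a.a. $t\in[0,T]$ $$\frac{d}{dt}\begin{pmatrix}p\\ -a\end{pmatrix}\in N_{\mathrm{C}+\begin{pmatrix}0\\ H a\end{pmatrix}}\begin{pmatrix}\sigma\\ a\end{pmatrix};$$ and $y$ is defined as $y=\sigma+Gr(t)-Ff(t)$. (ii) $\begin{pmatrix}y\\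 a\end{pmatrix}:[0,T]\to\mathbb{R}^{2m}$ is an absolutely continuous solution of the state-dependent sweeping process $$-\frac{d}{dt}\begin{pmatrix}y\\ a\end{pmatrix}\in N^{\mathbb{K}^{-1}}_{\mathcal{C}(t,a)}\begin{pmatrix}y\\ a\end{pmatrix}\quad\text{for a.a. }t\in[0,T],$$ where $$\mathbb{K}=\begin{pmatrix}K&0\\ 0&I\end{pmatrix},\qquad \mathcal{C}(t,a)=\left(\mathrm{C}+\begin{pmatrix}Gr(t)-Ff(t)\\ H a\end{pmatrix}\right)\cap(\mathcal{V}\times\mathbb{R}^m),$$ and, for all $t\in[0,T]$, $$\sigma=y-Gr(t)+Ff(t),\qquad \varepsilon=K^{-1}\sigma,\qquad p(t)=p(0)+\int_0^t\operatorname{diag}\left(\frac{\operatorname{sign}\sigma_i(\tau)}{s_i}\right)\dot a(\tau)\,d\tau,$$ $$x=\varepsilon+p,\qquad \zeta=\begin{pmatrix}D\\ R\end{pmatrix}^+\begin{pmatrix}x\\ -R\xi_0-r(t)\end{pmatrix},\qquad \begin{pmatrix}D\\ R\end{pmatrix}\zeta(0)=\begin{pmatrix}x(0)\\ -R\xi_0-r(0)\end{pmatrix},$$ where $\begin{pmatrix}D\\ R\end{pmatrix}^+=\left(D^\top D+R^\top R\right)^{-1}\begin{pmatrix}D^\top&R^\top\end{pmatrix}$ is the Moore-Penrose pseudoinverse. If instead $s_i\ge0$ for all $i$ with $s_i=0$ for some $i$, then it still holds that whenever $x,\varepsilon,p,\sigma,a,\zeta,y$ are as in (i), the function $\begin{pmatrix}y\\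 a\end{pmatrix}$ solves the state-dependent sweeping process $$-\frac{d}{dt}\begin{pmatrix}y\\ a\end{pmatrix}\in N^{\mathbb{K}^{-1}}_{\mathcal{C}(t,a)}\begin{pmatrix}y\\ a\end{pmatrix}\quad\text{for a.a. }t\in[0,T],$$ with $\mathbb{K}=\begin{pmatrix}K&0\\ 0&I\end{pmatrix}$ and $\mathcal{C}(t,a)=\left(\mathrm{C}+\begin{pmatrix}Gr(t)-Ff(t)\\ H a\end{pmatrix}\right)\cap(\mathcal{V}\times\mathbb{R}^m)$.
   Context: Lattice data. $d$ is the spatial dimension, $n$ the number of nodes, $m$ the number of springs, $q$ the number of external displacement constraints, $T>0$. $Q$ is the $n\times m$ incidence matrix of a directed graph: $Q_{ji}=1$ if node $j$ is the origin of spring $i$, $Q_{ji}=-1$ if node $j$ is its terminus, $Q_{ji}=0$ otherwise. $\xi_0\in\mathbb{R}^{nd}$ is the reference configuration (entry $d(j-1)+k$ is the $k$-th coordinate of node $j$), in which all springs have nonzero length. $\varphi:\mathbb{R}^{nd}\to\mathbb{R}^m$ is the length map $$\varphi_i(\xi)=\sqrt{\sum_{k=1}^d\Big(\sum_{j=1}^nQ_{ji}\xi_{d(j-1)+k}\Big)^2},$$ and $D:=D_{\xi_0}\varphi$ denotes its $m\times nd$ Jacobi matrix at $\xi_0$. $R$ is a given $q\times nd$ matrix, $r:[0,T]\to\mathbb{R}^q$ the displacement load, $f:[0,T]\to\mathbb{R}^{nd}$ the stress load. Spring parameters: $K=\operatorname{diag}(k_i)$, $H=\operatorname{diag}(h_i)$,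 and $$\mathrm{C}=\left\{\begin{pmatrix}\sigma\\ \alpha\end{pmatrix}\in\mathbb{R}^{2m}:-(c_{0,i}+s_i\alpha_i)\le\sigma_i\le c_{0,i}+s_i\alpha_i\ \text{ for all } i=1,\dots,m\right\}.$$ Matrices and subspaces. $F_1$ is the $m\times nd$ matrix made of the first $m$ rows of the Moore-Penrose pseudoinverse of the enhanced equilibrium matrix, $\begin{pmatrix}D^\top&R^\top\end{pmatrix}^+=\begin{pmatrix}D\\ R\end{pmatrix}(D^\top D+R^\top R)^{-1}$, i.e. $F_1=D(D^\top D+R^\top R)^{-1}$. Further, $$\mathcal{U}=K D\operatorname{Ker}R,\qquad \mathcal{V}=\{\sigma\in\mathbb{R}^m: D^\top\sigma\in\operatorname{Im}R^\top\}.$$ $U$ and $V$ are matrices whose columns form a basis of $\mathcal{U}$ and of $\mathcal{V}$, respectively; $$P_U=(U^\top K^{-1}U)^{-1}U^\top K^{-1},\quad P_V=(V^\top K^{-1}V)^{-1}V^\top K^{-1},\quad R^+=R^\top(RR^\top)^{-1},$$ $$G=VP_VKDR^+,\qquad F=UP_UF_1.$$ Normal cones. For a symmetric positive definite matrix $S$, a closed convex set $\mathcal{C}$ and a point $x\in\mathcal{C}$, $N^S_{\mathcal{C}}(x)=\{y:\ y^\top S(c-x)\le0\ \text{for all }c\in\mathcal{C}\}$, and $N_{\mathcal{C}}(x)=N^I_{\mathcal{C}}(x)$. The cone is defined only for $x\in\mathcal{C}$, so an inclusion into $N^S_{\mathcal{C}}(x)$ includes the requirement $x\in\mathcal{C}$.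 Here the ambient space is $\mathbb{R}^{2m}$. $\operatorname{sign}(0)=0$. A dot denotes the time derivative. *)

(* Defs.v *)
From HB Require Import structures.
From mathcomp Require Import all_boot all_order all_algebra.
From mathcomp Require Import all_classical all_reals all_analysis.

Set Implicit Arguments.
Unset Strict Implicit.
Unset Printing Implicit Defensive.

Import Order.TTheory GRing.Theory Num.Theory.
Import numFieldNormedType.Exports.

Local Open Scope classical_set_scope.
Local Open Scope ring_scope.

(* Vectors are column vectors. A function of time on [0, T] is a function on R
   of which only the values on [0, T] are used: the derivatives below occur
   almost everywhere, and in the interior of [0, T] they depend on no other
   value. *)

Section AbsoluteContinuity.
Variables (R : realType) (W : normedModType R).

Definition abs_continuous (b c : R) (g : R -> W) : Prop :=
  forall e : R, 0 < e -> exists2 dlt : R, 0 < dlt &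
    forall (N : nat) (u v : 'I_N -> R),
      (forall i, b <= u i /\ u i <= v i /\ v i <= c) ->
      trivIset setT (fun i => `]u i, v i[%classic) ->
      \sum_(i < N) (v i - u i) < dlt ->
      \sum_(i < N) `|g (v i) - g (u i)| < e.

End AbsoluteContinuity.

Section Cones.
Variables (R : realType) (N : nat).

Definition translate (A : set 'cV[R]_N) (v : 'cV[R]_N) : set 'cV[R]_N :=
  [set z + v | z in A].

(* Empty when x is not in A. *)
Definition normal_cone (S : 'M[R]_N) (A : set 'cV[R]_N) (x : 'cV[R]_N) :
    set 'cV[R]_N :=
  [set y | A x /\ forall c, A c -> (y^T *m S *m (c - x)) 0 0 <= 0].

Definition is_basis_of (b : nat) (B : 'M[R]_(N, b)) (A : set 'cV[R]_N) : Prop :=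
  \rank B = b /\ A = range (fun w : 'cV[R]_b => B *m w).

End Cones.

Section LatticeGeometry.
Variables (R : realType) (d n m : nat).

(* A spring with equal ends gets a zero column, hence zero length; such springs
   are excluded by the requirement on the reference configuration. *)
Definition incidence_mx (orig term : 'I_m -> 'I_n) : 'M[R]_(n, m) :=
  \matrix_(j, i) ((j == orig i)%:R - (j == term i)%:R).

(* mxvec_index j k : 'I_(n * d) is the position of coordinate k of node j. *)
Fact node_coordE (j : 'I_n) (k : 'I_d) :
  mxvec_index j k = (d * j + k)%N :> nat.
Proof.
have idx (s : seq 'I_n) (t : seq 'I_d) : j \in s -> k \in t ->
  index (j, k) [seq (x, y) | x <- s, y <- t]
  = (index j s * size t + index k t)%N.
  elim: s => // x s IHs js kt; rewrite allpairs_cons index_cat /=.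
  have [xj|xj] := eqVneq x j.
    by rewrite xj map_f// index_map// => y z [].
  rewrite ifF; last by apply/mapP => -[y _ [/eqP]]; rewrite eq_sym (negPf xj).
  rewrite size_map IHs ?mulSn ?addnA//.
  by move: js; rewrite inE eq_sym (negPf xj).
rewrite /= /enum_rank [enum_rank_in]unlock insubdK; last first.
  by rewrite -topredE /= cardE index_mem mem_enum.
rewrite enumT unlock /= /prod_enum idx ?mem_enum//.
by rewrite size_enum_ord !index_enum_ord mulnC.
Qed.

Definition length_map (Q : 'M[R]_(n, m)) (xi : 'cV[R]_(n * d)) : 'cV[R]_m :=
  \col_i Num.sqrt
    (\sum_(k < d) (\sum_(j < n) Q j i * xi (mxvec_index j k) 0) ^+ 2).

End LatticeGeometry.

(* Entry (i, l) is the partial derivative of g_i along the l-th coordinate; the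
   library's jacobian is for row vectors and acts on the right. *)
Definition jacobi_mx (R : realType) (N m : nat) (g : 'cV[R]_N -> 'cV[R]_m)
    (xi : 'cV[R]_N) : 'M[R]_(m, N) :=
  \matrix_(i, l) ('D_(delta_mx l 0) g xi) i 0.

Section LatticeMatrices.
Variables (R : realType) (N m q : nat).
Implicit Types (D : 'M[R]_(m, N)) (Rd : 'M[R]_(q, N)) (K : 'M[R]_m).

(* Moore-Penrose pseudoinverses of (D^T R^T), of (D; R) and of R, in the forms
   valid under Ker D `&` Ker R = {0} (the first two) and rank R = q (the
   last). *)
Definition pinv_equilibrium D Rd : 'M[R]_(m + q, N) :=
  col_mx D Rd *m invmx (D^T *m D + Rd^T *m Rd).
Definition pinv_compatibility D Rd : 'M[R]_(N, m + q) :=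
  invmx (D^T *m D + Rd^T *m Rd) *m row_mx D^T Rd^T.
Definition rpinv Rd : 'M[R]_(N, q) := Rd^T *m invmx (Rd *m Rd^T).

Definition space_U K D Rd : set 'cV[R]_m :=
  [set K *m D *m w | w in [set w : 'cV[R]_N | Rd *m w = 0]].
Definition space_V D Rd : set 'cV[R]_m :=
  [set sigma | range (fun l : 'cV[R]_q => Rd^T *m l) (D^T *m sigma)].

Definition proj_coef K (b : nat) (B : 'M[R]_(m, b)) : 'M[R]_(b, m) :=
  invmx (B^T *m invmx K *m B) *m B^T *m invmx K.

(* An element of R^(2m) is the column sigma on top of the column alpha. *)
Definition elastic_set (c0 s : 'I_m -> R) : set 'cV[R]_(m + m) :=
  [set z | forall i, - (c0 i + s i * dsubmx z i 0) <= usubmx z i 0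
                     /\ usubmx z i 0 <= c0 i + s i * dsubmx z i 0].

End LatticeMatrices.

Section EvolutionProblems.
Variables (R : realType) (N m q : nat) (T : R).

Definition lattice_problem (D : 'M[R]_(m, N)) (Rd : 'M[R]_(q, N))
    (xi0 : 'cV[R]_N) (K H : 'M[R]_m) (C : set 'cV[R]_(m + m))
    (F1 : 'M[R]_(m, N)) (r : R -> 'cV[R]_q) (f : R -> 'cV[R]_N)
    (x eps p sigma a : R -> 'cV[R]_m) (zeta : R -> 'cV[R]_N) : Prop :=
  [/\ [/\ abs_continuous 0 T x, abs_continuous 0 T eps & abs_continuous 0 T p],
      [/\ abs_continuous 0 T sigma, abs_continuous 0 T a
        & abs_continuous 0 T zeta],
      (forall t, 0 <= t <= T ->
        [/\ x t = eps t + p t,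
            sigma t = K *m eps t,
            D *m zeta t = x t,
            Rd *m (xi0 + zeta t) + r t = 0
          & range (fun l : 'cV[R]_q => Rd^T *m l)
              (D^T *m (- sigma t + F1 *m f t))])
    & {ae @lebesgue_measure R, forall t : R, 0 <= t <= T ->
        let z := fun tau : R => col_mx (p tau) (- a tau) in
        derivable z t 1 /\
        normal_cone 1%:M (translate C (col_mx 0 (H *m a t)))
          (col_mx (sigma t) (a t)) (z^`()%classic t)}].

Definition sweeping_solution (KK : 'M[R]_(m + m))
    (CC : R -> 'cV[R]_m -> set 'cV[R]_(m + m)) (y a : R -> 'cV[R]_m) : Prop :=
  let z := fun tau : R => col_mx (y tau) (a tau) in
  abs_continuous 0 T z /\
  {ae @lebesgue_measure R, forall t : R, 0 <= t <= T ->
    derivable z t 1 /\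
    normal_cone (invmx KK) (CC t (a t)) (z t) (- z^`()%classic t)}.

Definition sign_integral (s : 'I_m -> R) (sigma a : R -> 'cV[R]_m) (t : R) :
    'cV[R]_m :=
  \col_i (\int[@lebesgue_measure R]_(tau in `[0, t]%classic)
    (diag_mx (\row_j (Num.sg (sigma tau j 0) / s j)) *m a^`()%classic tau) i 0)%R.

End EvolutionProblems.

(* Main.v *)
Require Import Defs.
From HB Require Import structures.
From mathcomp Require Import all_boot all_order all_algebra.
From mathcomp Require Import all_classical all_reals all_analysis.
From mathcomp Require Import measurable_realfun ring lra.
Import Order.TTheory GRing.Theory Num.Theory.
Import numFieldNormedType.Exports.
Local Open Scope classical_set_scope.
Local Open Scope ring_scope.
Set Implicit Arguments.
Unset Strict Implicit.
Unset Printing Implicit Defensive.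

(* The spaces U and V are orthogonal complements for the scalar product of
   K^-1, so U P_U and V P_V are the complementary projections. The balance of
   forces fixes the U-component of sigma, and the compatibility of the
   displacements with x is equivalent to V P_V (sigma + K p) + G r being the
   constant - G R xi0; hence y = const - V P_V K p and - K^-1 y' agrees with p'
   on V, which turns the lattice inclusion into the sweeping one.

   Conversely, when all s_i > 0, normality forces a_i' >= 0, with a_i' = 0
   unless |sigma_i| = c0_i + s_i alpha_i. At such a point sigma_i <> 0 for almost
   every time: otherwise a_i would lie on the level set where the yield interval
   degenerates to a point (c0_i > 0 prevents h_i = 1), and a derivative vanishes
   almost everywhere on a level set. There the support of the yield domain is
   differentiable along V, and normality gives - K^-1 y' = sign(sigma) a' / s on V
   without any separation argument. The remaining analysis is that a is
   nondecreasing, that its derivative is therefore integrable, and that an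
   absolutely continuous function with zero derivative is constant. *)

(** * Absolutely continuous functions *)

Section AbsoluteContinuityClosure.
Context {R : realType}.
Implicit Types (W : normedModType R) (b c : R).

(** Both sums of increments are made smaller than half of [e / C'], where the maximum with 1 keeps
    the divisor positive. Sums use two dominating functions, linear images one. *)
Lemma abs_continuous_dominated W1 W2 W b c (C : R) (g1 : R -> W1) (g2 : R -> W2)
    (g : R -> W) :
  (forall u v, b <= u <= c -> b <= v <= c ->
    `|g v - g u| <= C * (`|g1 v - g1 u| + `|g2 v - g2 u|)) ->
  abs_continuous b c g1 -> abs_continuous b c g2 -> abs_continuous b c g.
Proof.
move=> dom ac1 ac2 e e0.
pose C' := Num.max C 1.
have C'0 : 0 < C' by rewrite lt_max ltr01 orbT.
have e'0 : 0 < e / C' / 2 by rewrite !divr_gt0.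
have [d1 d10 H1] := ac1 _ e'0; have [d2 d20 H2] := ac2 _ e'0.
exists (Num.min d1 d2); first by rewrite lt_min d10.
move=> N u v uv dis; rewrite lt_min => /andP[s1 s2].
apply: (@le_lt_trans _ _ (C' * (\sum_(i < N) `|g1 (v i) - g1 (u i)|
                               + \sum_(i < N) `|g2 (v i) - g2 (u i)|))).
  rewrite -big_split mulr_sumr; apply: ler_sum => i _ /=.
  have [bu [uvi vc]] := uv i.
  apply: le_trans (dom _ _ _ _) _.
  - by rewrite bu (le_trans uvi).
  - by rewrite vc (le_trans bu).
  - by rewrite ler_wpM2r ?addr_ge0// le_max lexx.
rewrite mulrC -ltr_pdivlMr// [ltRHS]splitr.
by apply: ltrD; [exact: H1|exact: H2].
Qed.

Lemma abs_continuousD W b c (g1 g2 : R -> W) :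
  abs_continuous b c g1 -> abs_continuous b c g2 ->
  abs_continuous b c (fun t => g1 t + g2 t).
Proof.
apply: (@abs_continuous_dominated _ _ _ _ _ 1) => u v _ _.
by rewrite mul1r opprD addrACA ler_normD.
Qed.

Lemma abs_continuous_dominated1 W1 W b c (C : R) (g1 : R -> W1) (g : R -> W) :
  (forall u v, b <= u <= c -> b <= v <= c ->
    `|g v - g u| <= C * `|g1 v - g1 u|) ->
  abs_continuous b c g1 -> abs_continuous b c g.
Proof.
move=> dom ac1; apply: (@abs_continuous_dominated _ _ _ _ _ `|C| _ _ _ _ ac1 ac1).
move=> u v ub vb; apply: le_trans (dom _ _ ub vb) _.
apply: (@le_trans _ _ (`|C| * `|g1 v - g1 u|)).
  by rewrite ler_wpM2r// ler_norm.
by rewrite ler_wpM2l// lerDl.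
Qed.

Lemma eq_abs_continuous W b c (g1 g : R -> W) :
  (forall t, b <= t <= c -> g1 t = g t) ->
  abs_continuous b c g1 -> abs_continuous b c g.
Proof.
move=> E; apply: (@abs_continuous_dominated1 _ _ _ _ 1) => u v ub vb.
by rewrite mul1r !E.
Qed.

Lemma abs_continuous_cst W b c (w : W) : abs_continuous b c (fun=> w).
Proof.
move=> e e0; exists 1 => // N u v _ _ _.
by rewrite big1// => i _; rewrite subrr normr0.
Qed.

Lemma abs_continuousZ b c (k : R) (g : R -> R) :
  abs_continuous b c g -> abs_continuous b c (fun t => k * g t).
Proof.
apply: (@abs_continuous_dominated1 _ _ _ _ `|k|) => u v _ _.
by rewrite -mulrBr normrM.
Qed.

Lemma abs_continuousN W b c (g : R -> W) :
  abs_continuous b c g -> abs_continuous b c (fun t => - g t).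
Proof.
apply: (@abs_continuous_dominated1 _ _ _ _ 1) => u v _ _.
by rewrite mul1r -opprD normrN.
Qed.

Lemma abs_continuous_sum W b c (I : Type) (s : seq I) (g : I -> R -> W) :
  (forall i, abs_continuous b c (g i)) ->
  abs_continuous b c (fun t => \sum_(i <- s) g i t).
Proof.
move=> acg; elim: s => [|i s IHs].
  by apply: eq_abs_continuous (abs_continuous_cst _ _ 0) => t _; rewrite big_nil.
apply: eq_abs_continuous (abs_continuousD (acg i) IHs) => t _.
by rewrite big_cons.
Qed.

Lemma le_normr_entry (k l : nat) (A : 'M[R]_(k, l)) i j : `|A i j| <= `|A|.
Proof.
rewrite [leRHS]/Num.Def.normr/= mx_normrE.
exact: (le_bigmax _ (fun ij : 'I_k * 'I_l => `|A ij.1 ij.2|) (i, j)).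
Qed.

Lemma abs_continuous_colP (k : nat) b c (g : R -> 'cV[R]_k) :
  abs_continuous b c g <-> forall i, abs_continuous b c (fun t => g t i 0).
Proof.
split=> [acg i|acg].
  apply: (abs_continuous_dominated1 (C := 1)) acg => u v _ _; rewrite mul1r.
  by have := le_normr_entry (g v - g u) i 0; rewrite !mxE.
have ac1 i : abs_continuous b c (fun t => g t i 0 *: delta_mx i 0 : 'cV[R]_k).
  apply: (@abs_continuous_dominated1 _ _ _ _ `|delta_mx i 0 : 'cV[R]_k| _ _ _ (acg i)).
  by move=> u v _ _; rewrite -scalerBl normrZ mulrC.
apply: eq_abs_continuous (abs_continuous_sum (index_enum _) ac1) => t _.
by rewrite [RHS]matrix_sum_delta; apply: eq_bigr => i _; rewrite big_ord1.
Qed.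

Lemma abs_continuous_mulmx (k l : nat) b c (A : 'M[R]_(k, l)) (g : R -> 'cV[R]_l) :
  abs_continuous b c g -> abs_continuous b c (fun t => A *m g t).
Proof.
move=> /abs_continuous_colP acg; apply/abs_continuous_colP => i.
have := abs_continuous_sum (index_enum _) (fun j => abs_continuousZ (A i j) (acg j)).
by apply: eq_abs_continuous => t _; rewrite mxE.
Qed.

Lemma abs_continuous_col_mx (k l : nat) b c (g1 : R -> 'cV[R]_k)
    (g2 : R -> 'cV[R]_l) :
  abs_continuous b c (fun t => col_mx (g1 t) (g2 t)) <->
  abs_continuous b c g1 /\ abs_continuous b c g2.
Proof.
split=> [acg|[ac1 ac2]].
  split.
    apply: eq_abs_continuous (abs_continuous_mulmx (row_mx 1%:M 0) acg) => t _.
    by rewrite mul_row_col mul1mx mul0mx addr0.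
  apply: eq_abs_continuous (abs_continuous_mulmx (row_mx 0 1%:M) acg) => t _.
  by rewrite mul_row_col mul1mx mul0mx add0r.
have := abs_continuousD (abs_continuous_mulmx (col_mx 1%:M 0) ac1)
                        (abs_continuous_mulmx (col_mx 0 1%:M) ac2).
apply: eq_abs_continuous => t _.
by rewrite !mul_col_mx !mul1mx !mul0mx add_col_mx addr0 add0r.
Qed.

(** The definition for a family of one interval. It later gives continuity of the stress, hence
    measurability of its sign. *)
Lemma abs_continuous_uniform W b c (g : R -> W) : abs_continuous b c g ->
  forall e, 0 < e -> exists2 dl, 0 < dl &
    forall u v, b <= u <= c -> b <= v <= c -> `|u - v| < dl -> `|g u - g v| < e.
Proof.
move=> acg e e0; have [dl dl0 H] := acg e e0; exists dl => // u v.
wlog uv : u v / u <= v => [hw ub vb|/andP[bu _] /andP[_ vc]].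
  case: (leP u v) => [|/ltW] uv; first exact: hw.
  by rewrite distrC => /hw; rewrite distrC; exact.
move=> duv; have := H 1 (fun=> u) (fun=> v); rewrite !big_ord1 distrC; apply.
- by [].
- by move=> i j _ _ _; rewrite !ord1.
- by rewrite -[ltLHS]ger0_norm ?subr_ge0// distrC.
Qed.

End AbsoluteContinuityClosure.

(** * Monotonicity from the sign of the derivative almost everywhere *)

Section Monotonicity.
Context {R : realType}.
Local Notation mu := (@lebesgue_measure R).

(** Outer regularity is applied to a measurable null set containing [A], which itself may fail to be
    measurable. *)
Lemma negligible_open_cover (A : set R) (e : R) : mu.-negligible A -> 0 < e ->
  exists U : set R, [/\ open U, A `<=` U & (mu U < e%:E)%E].
Proof.
move=> [B [mB B0 AB]] e0.
have [|U [oU BU UB]] := lebesgue_regularity_outer mB _ e0.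
  by rewrite [X in (X < _)%E]B0 ltry.
exists U; split=> //; first exact: subset_trans BU.
rewrite -(setDUK BU); apply: le_lt_trans (measureU2 _ _ _) _ => //.
  by apply: measurableD => //; exact: open_measurable.
by rewrite [X in (X + _ < _)%E]B0 add0e.
Qed.

(* The intervals of s are listed from right to left. *)
Let ordered_intervals (b t : R) (s : seq (R * R)) :=
  pairwise (fun p p' : R * R => p'.2 <= p.1) s &&
  all (fun p : R * R => (b <= p.1 <= p.2) && (p.2 <= t)) s.

Let ordered_intervalsW b t t' s : t <= t' ->
  ordered_intervals b t s -> ordered_intervals b t' s.
Proof.
move=> tt' /andP[? /allP al]; apply/andP; split => //.
by apply/allP => p /al /andP[-> /le_trans]; exact.
Qed.

Let ordered_intervals_trivIset b t s : ordered_intervals b t s ->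
  trivIset setT (fun i : 'I_(size s) =>
    `](nth (0, 0) s i).1, (nth (0, 0) s i).2[%classic).
Proof.
move=> /andP[/(pairwiseP (0, 0)) pw _].
have {}pw i j : (i < j)%N -> (j < size s)%N ->
    (nth (0, 0) s j).2 <= (nth (0, 0) s i).1.
  by move=> ij js; apply: pw => //; rewrite inE (ltn_trans ij).
move=> i j _ _ [x []] /=; rewrite !in_itv/= => /andP[ix xi] /andP[jx xj].
apply/val_inj; case: (ltngtP i j) => // ij.
  have := pw _ _ ij (ltn_ord j); move=> /(lt_le_trans xj) /(lt_trans ix).
  by rewrite ltxx.
have := pw _ _ ij (ltn_ord i); move=> /(lt_le_trans xi) /(lt_trans jx).
by rewrite ltxx.
Qed.

(** The open intervals are disjoint, so their total length is the measure of their union, a subset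
    of [U]. *)
Let ordered_intervals_length b t s (U : set R) : ordered_intervals b t s ->
  (forall p, p \in s -> `]p.1, p.2[ `<=` U) -> measurable U ->
  ((\sum_(i < size s) ((nth (0, 0) s i).2 - (nth (0, 0) s i).1))%:E <= mu U)%E.
Proof.
move=> os sU mU; have tr := ordered_intervals_trivIset os.
pose F (i : 'I_(size s)) := `](nth (0, 0) s i).1, (nth (0, 0) s i).2[%classic.
have -> : ((\sum_(i < size s) ((nth (0, 0) s i).2 - (nth (0, 0) s i).1))%:E =
    mu (\big[setU/set0]_(i < size s) F i))%E.
  rewrite -sumEFin; transitivity (\sum_(i < size s) mu (F i))%E.
    apply: eq_bigr => i _.
    rewrite lebesgue_measure_itv/= lte_fin; case: ifPn => //.
    move/andP: os => [_ /(all_nthP (0, 0))] /(_ i (ltn_ord i)).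
    rewrite -leNgt => /andP[/andP[_ le1] _] le2.
    by rewrite (le_anti (introT andP (conj le1 le2))) subrr.
  apply/esym/(@measure_bigsetU_ord _ _ _ mu _ xpredT F) => //.
  by move=> i; exact: measurable_itv.
apply: le_measure; rewrite ?inE//.
  by apply: bigsetU_measurable => i _; exact: measurable_itv.
rewrite -bigcup_seq => x [i _]; apply: sU.
exact: mem_nth.
Qed.

(* The partition of [b, c] into intervals on which the growth is controlled by
   the derivative and intervals included in a small neighbourhood of the
   exceptional set is obtained as in Cousin's lemma. *)
Lemma abs_continuous_le b c (g : R -> R) : b <= c -> abs_continuous b c g ->
  {ae mu, forall t, b <= t <= c -> derivable g t 1 /\ 0 <= g^`()%classic t} ->
  g b <= g c.
Proof.
move=> bc acg aeg.
(* The error has two sources: [e * (c - b)] from slopes bounded below by [- e], and one [e] from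
   absolute continuity on the intervals near the exceptional set. *)
suff H e : 0 < e -> g b <= g c + e * (1 + (c - b)).
  apply/ler_addgt0Pr => e e0.
  have D0 : 0 < 1 + (c - b) by rewrite ltr_wpDr// subr_ge0.
  by have := H (e / (1 + (c - b))) (divr_gt0 e0 D0); rewrite divfK ?gt_eqF.
move=> e0; have [dl dl0 Hdl] := acg _ e0.
pose E := ~` [set t | b <= t <= c -> derivable g t 1 /\ 0 <= g^`()%classic t] `|` [set b; c].
have nE : mu.-negligible E.
  apply: negligibleU => //; apply/negligibleP.
    by apply: measurableU; exact: measurable_set1.
  apply/eqP; rewrite -measure_le0 (le_trans (measureU2 _ _ _))//.
  by rewrite /= !lebesgue_measure_set1 adde0.
have [U [oU EU mUd]] := negligible_open_cover nE dl0.
(* The list [s] keeps the intervals of a partition of [[b, t]] that lie in [U]; on the others [g]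
   decreases by at most [e] times the length. *)
pose good t s := [/\ ordered_intervals b t s,
  (forall p, p \in s -> `]p.1, p.2[ `<=` U)
  & g b <= g t + e * (t - b) + \sum_(p <- s) `|g p.2 - g p.1|].
(* Around a point of [E] the interval [(u, v)] fits in [U] and joins the list. Around any other
   point the derivative is nonnegative, so the slopes on both sides exceed [- e] and the list is
   unchanged. *)
have step t : b <= t <= c -> exists2 h, 0 < h & forall u v,
    b <= u <= t -> t <= v <= c -> t - u < h -> v - t < h ->
    forall s, good u s -> exists s', good v s'.
  move=> /andP[bt tc]; have [Et|nEt] := pselect (E t).
    have [h /= h0 hU] : nbhs t U by apply: open_nbhs_nbhs; split => //; exact: EU.
    exists h => // u v /andP[bu ut] /andP[tv vc] uh vh s [os sU gb].
    have uv : u <= v := le_trans ut tv.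
    exists ((u, v) :: s); split.
    - move: (ordered_intervalsW uv os); rewrite /ordered_intervals /=.
      move=> /andP[-> ->]; rewrite bu uv lexx !andbT/=.
      by move: os => /andP[_ /allP al]; apply/allP => p /al /andP[].
    - move=> p; rewrite inE => /predU1P[->|/sU//] x /=; rewrite in_itv/= => /andP[ux xv].
      apply: hU; rewrite /ball_/=/ball_/= ltr_norml.
      by apply/andP; split; lra.
    - rewrite big_cons/=; apply: le_trans gb _.
      have : g u <= g v + `|g v - g u|.
        by have := ler_norm (g u - g v); rewrite distrC; lra.
      have : e * (u - b) <= e * (v - b) by rewrite ler_wpM2l ?(ltW e0)// lerB.
      by lra.
  move: nEt => /not_orP[/contrapT/=]; rewrite bt tc => /(_ isT) [dgt gt0] /not_orP[].
  move=> /eqP tb /eqP tc'.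
  have : (fun h => h^-1 *: (g (h *: 1 + t) - g t)) @ 0^' --> g^`()%classic t.
    by rewrite derive1E; exact: dgt.
  move=> /cvgrPdist_lt /(_ _ e0) [h /= h0 Hh].
  have slope k : `|k| < h -> k != 0 -> k^-1 * (g (k + t) - g t) > - e.
    move=> kh k0; have := Hh k; rewrite /ball_/= sub0r normrN => /(_ kh k0).
    rewrite [k *: _]mulr1 ltr_norml => /andP[_].
    by rewrite /GRing.scale/=; lra.
  exists h => // u v /andP[bu ut] /andP[tv vc] uh vh s [os sU gb].
  exists s; split => //; first exact: ordered_intervalsW (le_trans ut tv) os.
  apply: le_trans gb _; rewrite lerD2r.
  have gtu : g u <= g t + e * (t - u).
    have [->|ut'] := eqVneq u t; first by rewrite subrr mulr0 addr0.
    have {}ut' : u - t < 0 by rewrite subr_lt0 lt_neqAle ut'.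
    have := slope (u - t); rewrite subrK ltr0_norm// opprB uh lt_eqF// => /(_ isT isT).
    by rewrite mulrC ltr_ndivlMr//; lra.
  have gtv : g t <= g v + e * (v - t).
    have [->|vt'] := eqVneq v t; first by rewrite subrr mulr0 addr0.
    have {}vt' : 0 < v - t by rewrite subr_gt0 lt_neqAle eq_sym vt'.
    have := slope (v - t); rewrite subrK gtr0_norm// vh gt_eqF// => /(_ isT isT).
    by rewrite mulrC ltr_pdivlMr//; lra.
  lra.
(* Some [u] in [S] is close enough to [sup S] for [step] to carry it past [sup S], unless [sup S] is
   [c], which is then reached. *)
pose S := [set t | b <= t <= c /\ exists s, good t s].
have Sb : S b.
  split; first by rewrite lexx.
  by exists [::]; split => //; rewrite big_nil addr0 subrr mulr0 addr0.
have supS : has_sup S.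
  by split; [exists b | exists c => t [/andP[]]].
have bz : b <= sup S by apply: ub_le_sup => //; exact: supS.2.
have zc : sup S <= c by apply: ge_sup; [exact: supS.1 | move=> t [/andP[]]].
have [h h0 Hh] := step (sup S) (introT andP (conj bz zc)).
have [u [/andP[bu uc] [s gus]] zu] := sup_adherent h0 supS.
have uz : u <= sup S.
  by apply: ub_le_sup; [exact: supS.2|split; [rewrite bu|exists s]].
have cS : S c.
  have [zc'|cz] := ltP (sup S) c.
    pose v := Num.min c (sup S + h / 2).
    have zv : sup S < v by rewrite lt_min zc' ltrDl divr_gt0.
    have vc : v <= c by rewrite ge_min lexx.
    have vh : v <= sup S + h / 2 by rewrite ge_min lexx orbT.
    have Sv : S v.
      split; first by rewrite vc (le_trans bz (ltW zv)).
      apply: (Hh u v) gus; rewrite ?bu ?uz ?(ltW zv) ?vc//; last by lra.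
      by rewrite ltrBlDl -ltrBlDr.
    have : v <= sup S by apply: ub_le_sup => //; exact: supS.2.
    by rewrite leNgt zv.
  have {cz} zc' : sup S = c by apply/eqP; rewrite eq_le zc cz.
  split; first by rewrite bc lexx.
  apply: (Hh u c) gus; rewrite ?bu ?uz ?zc' ?lexx ?subrr//.
  by rewrite ltrBlDl -ltrBlDr -zc'.
move: cS => [_ {gus zu uc uz bu}[{}s [os sU gb]]].
(* The listed intervals have total length below [dl], as they are disjoint and lie in [U]; absolute
   continuity bounds the remaining sum by [e]. *)
apply: le_trans gb _; rewrite -addrA lerD2l (mulrDr e 1) mulr1 addrC lerD2r.
rewrite (big_nth (0, 0)) big_mkord; apply/ltW/Hdl.
- move=> i; move/andP: os => [_ /(all_nthP (0, 0))] /(_ i (ltn_ord i)).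
  by move=> /andP[/andP[-> ->] ->].
- exact: ordered_intervals_trivIset os.
- rewrite -lte_fin; apply: le_lt_trans mUd.
  by apply: ordered_intervals_length os _ _ => //; exact: open_measurable.
Qed.

End Monotonicity.

#[global] Instance ae_lebesgue_filter (R : realType) :
  Filter (nbhs (almost_everywhere (@lebesgue_measure R))).
Proof. exact: (ae_filter_ringOfSetsType (@lebesgue_measure R)). Qed.

(** * Consequences of monotonicity, and primitives of integrable functions *)

Section Primitives.
Context {R : realType}.
Local Notation mu := (@lebesgue_measure R).

Lemma abs_continuousS (W : normedModType R) (b c b' c' : R) (g : R -> W) :
  b <= b' -> c' <= c -> abs_continuous b c g -> abs_continuous b' c' g.
Proof.
move=> bb cc acg e e0; have [dl dl0 H] := acg e e0; exists dl => // N u v uv.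
by apply: H => i; have [? [? ?]] := uv i; split; [|split]; lra.
Qed.

Lemma abs_continuous_nondecreasing (b c : R) (g : R -> R) :
  abs_continuous b c g ->
  {ae mu, forall t, b <= t <= c -> derivable g t 1 /\ 0 <= g^`()%classic t} ->
  {in `[b, c] &, {homo g : x y / x <= y}}.
Proof.
move=> acg aeg u v; rewrite !in_itv/= => /andP[bu uc] /andP[bv vc] uv.
apply: abs_continuous_le => //; first exact: abs_continuousS acg.
apply: filterS aeg => t + /andP[ut tv]; apply.
by rewrite (le_trans bu)// (le_trans tv).
Qed.

(** Monotonicity of both [g] and [- g]. Continuity alone would not suffice, as the Cantor function
    shows. *)
Lemma abs_continuous_cst_eq (b c : R) (g : R -> R) : abs_continuous b c g ->
  {ae mu, forall t, b <= t <= c -> derivable g t 1 /\ g^`()%classic t = 0} ->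
  forall t, b <= t <= c -> g t = g b.
Proof.
move=> acg aeg t /[dup] tbc /andP[bt tc]; have bc := le_trans bt tc.
apply/eqP; rewrite eq_le; apply/andP; split; last first.
  apply: (abs_continuous_nondecreasing acg); rewrite ?in_itv/= ?lexx ?bc//.
  by apply: filterS aeg => u /[apply] -[? ->].
rewrite -lerN2.
apply: (abs_continuous_nondecreasing (abs_continuousN acg));
  rewrite ?in_itv/= ?lexx ?bc//.
apply: filterS aeg => u /[apply] -[dg g0]; split; first exact: derivableN.
by rewrite derive1E deriveN// -derive1E g0 oppr0.
Qed.

Lemma ae_neq (x : R) : {ae mu, forall t, t != x}.
Proof.
have -> : {ae mu, forall t, t != x} = mu.-negligible [set x].
  congr (mu.-negligible _); apply/seteqP; split => y /=.
    by move=> /negP; rewrite negbK => /eqP.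
  by move=> ->; rewrite eqxx.
by apply/negligibleP; [exact: measurable_set1|exact: lebesgue_measure_set1].
Qed.

Section Primitive.
Variables (w : R -> R) (b : R).
Hypothesis intw : mu.-integrable setT (EFin \o w).
Let P t := (\int[mu]_(x in `[b, t]) w x)%R.

Let intwS A : measurable A -> mu.-integrable A (EFin \o w).
Proof. by move=> mA; exact: integrableS intw. Qed.

Let primitiveB u v : b <= u -> u <= v ->
  P v - P u = (\int[mu]_(x in `]u, v[) w x)%R.
Proof.
move=> bu uv; rewrite /P Rintegral_itvB ?bnd_simp//; last exact: intwS.
by rewrite -Rintegral_itv_bndo_bndc//; exact: intwS.
Qed.

(** The increments are bounded by integrals of [|w|] over disjoint intervals, which add up to one
    integral over a set of small measure. *)
Lemma abs_continuous_primitive c : abs_continuous b c P.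
Proof.
move=> e e0; have [dl [dl0 H]] := integral_normr_continuous intw e0.
exists dl => // N u v uv tr sd.
pose F (i : 'I_N) := `]u i, v i[%classic : set R.
have mF i : measurable (F i) by exact: measurable_itv.
apply: (@le_lt_trans _ _ (\sum_(i < N) \int[mu]_(x in F i) `|w x|)%R).
  apply: ler_sum => i _; have [bu [uvi vc]] := uv i.
  by rewrite primitiveB//; apply: le_normr_Rintegral => //; exact: intwS.
have mU : measurable (\big[setU/set0]_(i < N) F i).
  by apply: bigsetU_measurable => i _; exact: mF.
have mw : measurable_fun setT w by case/integrableP : intw => /measurable_EFinP.
suff E : (\sum_(i < N) \int[mu]_(x in F i) `|w x| =
    \int[mu]_(x in \big[setU/set0]_(i < N) F i) `|w x|)%R.
  rewrite E; apply: H => //.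
  rewrite [ltLHS](@measure_bigsetU_ord _ _ _ mu _ xpredT F)//.
  rewrite (eq_bigr (fun i => (v i - u i)%:E)); last first.
    move=> i _; rewrite /= lebesgue_measure_itv/= lte_fin; case: ifPn => //.
    have [bu [uvi vc]] := uv i; rewrite -leNgt => vu.
    by rewrite (le_anti (introT andP (conj uvi vu))) subrr.
  by rewrite sumEFin lte_fin.
rewrite /Rintegral ge0_integral_bigsetU//=.
- rewrite -sum_fine// => i _.
  have /integrableP[_] := integrable_abse (intwS (mF i)).
  under eq_integral do rewrite /= normr_id.
  by move=> ?; rewrite ge0_fin_numE//; apply: integral_ge0.
- exact: index_enum_uniq.
- by move=> i j _ _; exact: tr.
- apply/measurable_EFinP/measurable_funTS; exact: measurableT_comp.
Qed.

Lemma derivable_primitive :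
  {ae mu, forall t, b < t -> derivable P t 1 /\ P^`()%classic t = w t}.
Proof.
have locw : locally_integrable setT w by exact: open_integrable_locally openT intw.
have := @FTC1 R w (BLeft b) (fun y => intwS (measurable_itv _)) locw.
apply: filterS => t Ht bt; apply: Ht.
by rewrite lte_fin.
Qed.

End Primitive.

Import HBNNSimple.

(** For a simple function [h] below [w], bounded and hence integrable on [[b, c]], the difference of
    [g] and the primitive of [h] has a nonnegative derivative. Monotonicity bounds the integral of
    each [h], so integrability of [w] comes out as a consequence. *)
Lemma le_integral_derivative (b c : R) (g w : R -> R) : b <= c ->
  abs_continuous b c g ->
  {ae mu, forall t, b <= t <= c -> derivable g t 1 /\ 0 <= g^`()%classic t} ->
  (forall t, 0 <= w t) -> (forall t, w t != 0 -> b <= t <= c) ->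
  {ae mu, forall t, b <= t <= c -> w t = g^`()%classic t} ->
  (\int[mu]_x (w x)%:E <= (g c - g b)%:E)%E.
Proof.
move=> bc acg aeg w0 wbc aew.
rewrite ge0_integralTE; last by move=> x; rewrite lee_fin.
apply: ge_ereal_sup => _ [h /= hw <-].
have hw' x : h x <= w x by rewrite -lee_fin.
have h0 x : 0 <= h x by exact: fun_ge0.
have hbc x : ~ (b <= x <= c) -> h x = 0.
  move=> xbc; apply/le_anti; rewrite h0 andbT (le_trans (hw' x))//.
  by rewrite leNgt lt_neqAle w0 andbT eq_sym; apply/negP => /wbc.
have inth : mu.-integrable setT (EFin \o h).
  have -> : EFin \o h = (EFin \o h) \_ `[b, c].
    apply/funext => x; rewrite patchE; case: ifPn => // /negP.
    by rewrite inE/= in_itv/= => /hbc /= ->.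
  apply/(integrable_mkcond _ _).1 => //.
  apply: measurable_bounded_integrable => //.
  - by rewrite [X in (X < _)%E](lebesgue_measure_itv `[b, c]); case: ifP; rewrite /= ?ltry.
  - exact/measurable_funTS/measurable_funPT.
  - by apply: sub_boundedr (simple_bounded h) => A /= HA x _; exact: HA.
have acP := abs_continuous_primitive b inth c.
have dP := derivable_primitive b inth.
set P := (fun t => _) in acP dP.
have -> : sintegral mu h = (P c)%:E.
  rewrite -[X in sintegral _ X](_ : h \_ `[b, c] = _); last first.
    apply/funext => x; rewrite patchE; case: ifPn => // /negP.
    by rewrite inE/= in_itv/= => /hbc /= ->.
  rewrite -integral_nnsfun// /P /Rintegral fineK//.
  by apply: integrable_fin_num => //; exact: integrableS inth.
rewrite lee_fin.
have := @abs_continuous_le _ b c (fun t => g t - P t) bc.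
have P0 : P b = 0 by rewrite /P set_itv1 Rintegral_set1.
rewrite P0 subr0 lerBrDr addrC -lerBrDr; apply.
  apply: abs_continuousD => //; exact: abs_continuousN.
apply: filterS3 aeg dP (filterI aew (ae_neq b)) => t aegt dPt [aewt tb] /[dup] tbc /andP[bt tc].
have [dgt g0] := aegt tbc; have [|dPt' Pt] := dPt; first by rewrite lt_neqAle eq_sym tb.
split; first exact: derivableB.
by rewrite derive1E deriveB// -!derive1E Pt subr_ge0 -aewt.
Qed.

End Primitives.

(** * Null sets, level sets and measurability of derivatives *)

Section NullSets.
Context {R : realType}.
Local Notation mu := (@lebesgue_measure R).

Import HBNNSimple.

(** The integral is a supremum over simple functions. Setting such a function to zero on the
    measurable null set [N] keeps its integral and puts it below [g] everywhere. *)
Let le_integral_ae (f g : R -> \bar R) :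
  (forall x, 0 <= f x)%E -> (forall x, 0 <= g x)%E ->
  {ae mu, forall x, (f x <= g x)%E} -> (\int[mu]_x f x <= \int[mu]_x g x)%E.
Proof.
move=> f0 g0 [N [mN N0 fgN]]; rewrite !ge0_integralTE//.
apply: ge_ereal_sup => _ [h /= hf <-].
have mNC : measurable (~` N) by exact: measurableC.
pose h' := proj_nnsfun h mNC.
have -> : sintegral mu h = sintegral mu h'.
  rewrite -[X in sintegral _ X](patch_setT (cst 0)) -[X in _ = sintegral _ X](patch_setT (cst 0)).
  rewrite -!integral_nnsfun//; apply: ae_eq_integral => //.
  - exact/measurable_EFinP/measurable_funPT.
  - exact/measurable_EFinP/measurable_funPT.
  exists N; split => // x /= /not_implyP[_] hx; apply: contrapT => Nx; apply: hx.
  by rewrite mindicE mem_set//= mulr1.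
apply: ereal_sup_ubound; exists h' => //= x; rewrite mindicE.
have [xN|xN] := pselect (N x).
  by rewrite memNset ?mulr0//=; exact.
rewrite mem_set// mulr1; apply: le_trans (hf x) _.
by apply: contrapT => fg; apply: xN; exact: fgN.
Qed.

(* Stated without measurability, because a^`() is not shown to be measurable. *)
Lemma Rintegral_ae (D : set R) (f g : R -> R) :
  {ae mu, forall x, D x -> f x = g x} ->
  (\int[mu]_(x in D) f x = \int[mu]_(x in D) g x)%R.
Proof.
move=> fg; rewrite /Rintegral; congr fine; rewrite integralE [RHS]integralE.
have aefg : {ae mu, forall x, (EFin \o f) \_ D x = (EFin \o g) \_ D x}.
  apply: filterS fg => x fg; rewrite !patchE; case: ifPn => // /set_mem Dx.
  by rewrite /= fg.
have main (u v : R -> \bar R) : (forall x, 0 <= u x)%E -> (forall x, 0 <= v x)%E ->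
    {ae mu, forall x, u x = v x} -> (\int[mu]_x u x = \int[mu]_x v x)%E.
  move=> u0 v0 uv; apply/le_anti/andP; split; apply: le_integral_ae => //;
    by apply: filterS uv => x ->.
congr (_ - _)%E; rewrite integral_mkcond [RHS]integral_mkcond; apply: main.
- by move=> x; apply: erestrict_ge0.
- by move=> x; apply: erestrict_ge0.
- apply: filterS aefg => x; rewrite !patchE; case: ifPn => // _.
  by rewrite !funeposE /= => -[->].
- by move=> x; apply: erestrict_ge0.
- by move=> x; apply: erestrict_ge0.
- apply: filterS aefg => x; rewrite !patchE; case: ifPn => // _.
  by rewrite !funenegE /= => -[->].
Qed.

(** The isolated points of a level set are countable, hence form a null set; at any other point the
    difference quotient has zeros arbitrarily near, so its limit is zero. *)
Lemma derive1_level_set (g : R -> R) (k : R) :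
  {ae mu, forall t, derivable g t 1 -> g t = k -> g^`()%classic t = 0}.
Proof.
have nI : mu.-negligible (isolated [set t | g t = k]).
  have cI := countable_isolated [set t | g t = k].
  exists (isolated [set t | g t = k]); split => //; last exact: countable_lebesgue_measure0.
  exact: countable_measurable.
apply: negligibleS nI => t /= /not_implyP[dg /not_implyP[gt]] g'0.
split; first exact: mem_set.
apply: contrapT => niso; apply: g'0; apply/eqP; apply: contrapT => /negP l0.
have : (fun h => h^-1 *: (g (h *: 1 + t) - g t)) @ 0^' --> g^`()%classic t.
  by rewrite derive1E; exact: dg.
have ln0 : 0 < `|g^`()%classic t| by rewrite normr_gt0.
move=> /cvgrPdist_lt /(_ _ ln0) [h /= h0 Hh].
(* On this ball the quotient differs from the derivative by less than its absolute value, so it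
   cannot vanish and [t] is isolated. *)
apply: niso; exists (ball t h); first exact: nbhsx_ballx.
apply/seteqP; split => [x [tx gx]|x ->]; last by split => //; exact: ballxx.
apply: contrapT => /eqP xt.
have := Hh (x - t); rewrite /ball_/= sub0r normrN distrC => /(_ tx).
rewrite subr_eq0 => /(_ xt); rewrite [_ *: 1]mulr1 subrK gx gt subrr scaler0 subr0.
by rewrite ltxx.
Qed.

(** A monotone function is measurable, and so is the upper limit of its difference quotients with
    steps [1 / (n + 1)]. As [g] is only controlled on [[b, c]], it is frozen outside by [clamp]. *)
Lemma derive1_measurable_representative (b c : R) (g : R -> R) : b <= c ->
  {in `[b, c] &, {homo g : x y / x <= y}} ->
  exists w : R -> R, [/\ measurable_fun setT w, (forall t, 0 <= w t),
    (forall t, w t != 0 -> b <= t <= c) &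
    forall t, b < t < c -> derivable g t 1 -> 0 <= g^`()%classic t ->
      w t = g^`()%classic t].
Proof.
move=> bc ndg; pose clamp (t : R) := Num.max b (Num.min t c).
have clampbc t : clamp t \in `[b, c].
  by rewrite in_itv/= /clamp le_max lexx/= ge_max bc ge_min lexx orbT.
have clampE t : b <= t <= c -> clamp t = t.
  by move=> /andP[bt tc]; rewrite /clamp (min_l tc) (max_r bt).
have clamp_nd : {homo clamp : x y / x <= y}.
  move=> x y xy; rewrite /clamp.
  have : Num.min x c <= Num.min y c by case: (leP x c) => ?; case: (leP y c) => ?; lra.
  move: (Num.min x c) (Num.min y c) => x' y' xy'.
  by case: (leP b x') => ?; case: (leP b y') => ?; lra.
pose G t := g (clamp t).
have Gnd : {homo G : x y / x <= y}.
  by move=> x y xy; apply: ndg => //; exact: clamp_nd.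
have mG : measurable_fun setT G.
  by apply: nondecreasing_measurable => // x y xy; exact: Gnd.
pose q n t := (n.+1%:R * (G (t + n.+1%:R^-1) - G t))%:E.
have mq n : measurable_fun setT (q n).
  apply/measurable_EFinP/measurable_funM => //; apply: measurable_funB => //.
  apply: nondecreasing_measurable => // x y xy.
  by apply: Gnd; rewrite lerD2r.
(* [fine] and the absolute value make [w] finite and nonnegative everywhere; they change nothing
   where the limit is a nonnegative derivative. *)
pose w t := if (b <= t) && (t <= c) then `|fine (limn_esup (q^~ t))| else 0.
exists w; split.
- apply: measurable_fun_ifT.
  + apply: measurable_and; apply: measurable_fun_ler => //.
  + apply: measurableT_comp => //; apply: measurableT_comp; first exact: fine_measurable.
    exact: measurable_fun_limn_esup.
  + exact: measurable_cst.
- by move=> t; rewrite /w; case: ifP.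
- by move=> t; rewrite /w; case: ifP => //; rewrite eqxx.
move=> t /andP[bt tc] dg g0.
rewrite /w (ltW bt) (ltW tc)/=.
suff -> : limn_esup (q^~ t) = (g^`()%classic t)%:E by rewrite /= ger0_norm.
have cvq : q^~ t @ \oo --> (g^`()%classic t)%:E.
  apply: cvg_EFin; first by near=> n.
  have : (fun h => h^-1 *: (g (h *: 1 + t) - g t)) @ 0^' --> g^`()%classic t.
    by rewrite derive1E; exact: dg.
  move=> /cvgrPdist_lt dgt; apply/cvgrPdist_lt => e e0.
  have [h /= h0 Hh] := dgt _ e0.
  have hc : 0 < Num.min h (c - t) by rewrite lt_min h0 subr_gt0.
  near=> n.
  have : n.+1%:R^-1 < Num.min h (c - t).
    near: n; exact: near_infty_natSinv_lt (PosNum hc).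
  rewrite lt_min => /andP[nh nc].
  have := Hh n.+1%:R^-1; rewrite /ball_/= sub0r normrN ger0_norm ?invr_ge0// => /(_ nh).
  rewrite invr_eq0 pnatr_eq0 => /(_ isT); rewrite invrK [_ *: 1]mulr1.
  have n0 : 0 <= n.+1%:R^-1 :> R by rewrite invr_ge0.
  have tn : b <= t + n.+1%:R^-1 <= c.
    by move: nc n0; move: (n.+1%:R^-1) => x ? ?; apply/andP; split; lra.
  by rewrite /q /G (clampE t) ?(ltW bt) ?(ltW tc)// (clampE _ tn) (addrC t).
by rewrite is_cvg_limn_esupE; [exact/cvg_lim|apply/cvg_ex; eexists; exact: cvq].
Unshelve. all: by end_near. Qed.

(** Almost everywhere [S] equals a bounded measurable factor times a measurable version of the
    derivative of [a], whose integral is at most [a T - a 0]. Hence [P] is the primitive of an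
    integrable function. *)
Lemma sign_primitive (T s : R) (sigma a S : R -> R) : 0 <= T -> 0 < s ->
  abs_continuous 0 T sigma -> abs_continuous 0 T a ->
  {ae mu, forall t, 0 <= t <= T -> derivable a t 1 /\ 0 <= a^`()%classic t} ->
  {ae mu, forall t, 0 <= t <= T -> S t = Num.sg (sigma t) / s * a^`()%classic t} ->
  let P t := (\int[mu]_(x in `[0, t]) S x)%R in
  abs_continuous 0 T P /\
  {ae mu, forall t, 0 <= t <= T -> derivable P t 1 /\ P^`()%classic t = S t}.
Proof.
move=> T0 s0 acs aca aea aeS P.
have nda := abs_continuous_nondecreasing aca aea.
have [w [mw w0 wT wE]] := derive1_measurable_representative T0 nda.
have aew : {ae mu, forall t, 0 <= t <= T -> w t = a^`()%classic t}.
  apply: filterS3 aea (ae_neq 0) (ae_neq T) => t aet t0 tT /[dup] /aet[da a0] /andP[? ?].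
  by apply: wE => //; rewrite !lt_neqAle eq_sym t0 tT; apply/andP.
have intw : mu.-integrable setT (EFin \o w).
  apply/integrableP; split; first exact/measurable_EFinP.
  under eq_integral do rewrite /= ger0_norm//.
  exact: le_lt_trans (le_integral_derivative T0 aca aea w0 wT aew) (ltry _).
pose clamp (t : R) := Num.max 0 (Num.min t T).
have clampT t : 0 <= clamp t <= T.
  by rewrite /clamp le_max lexx/= ge_max T0 ge_min lexx orbT.
have clampE t : 0 <= t <= T -> clamp t = t.
  by move=> /andP[t0 tT]; rewrite /clamp (min_l tT) (max_r t0).
have clamp_lip x y : `|clamp x - clamp y| <= `|x - y|.
  rewrite /clamp; apply: (@le_trans _ _ `|Num.min x T - Num.min y T|).
    move: (Num.min x T) (Num.min y T) => x' y'.
    case: (leP 0 x') => ?; case: (leP 0 y') => ?; rewrite ?subrr ?normr0 ?normr_ge0//.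
      by rewrite subr0 !ger0_norm//; lra.
    by rewrite distrC subr0 distrC !ger0_norm//; lra.
  case: (leP x T) => ?; case: (leP y T) => ?; rewrite ?subrr ?normr0 ?normr_ge0//.
    by rewrite distrC [leRHS]distrC !ger0_norm; lra.
  by rewrite !ger0_norm; lra.
(* [sigma] is controlled on [[0, T]] only; the 1-Lipschitz [clamp] extends it continuously to the
   line. *)
have cs : continuous (sigma \o clamp).
  move=> x; apply/cvgrPdist_lt => e e0.
  have [dl dl0 H] := abs_continuous_uniform acs e0.
  near=> y; apply: H => //; apply: le_lt_trans (clamp_lip _ _) _.
  by near: y; exact: cvgr_dist_lt.
have ms : measurable_fun setT (fun t => Num.sg (sigma (clamp t)) / s).
  apply: measurable_funM => //.
  apply: (measurableT_comp (f := @Num.sg R)); last exact: continuous_measurable_fun cs.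
  apply: nondecreasing_measurable => // x y xy.
  by case: (sgrP x) xy; case: (sgrP y) => //; lra.
pose v t := Num.sg (sigma (clamp t)) / s * w t.
have intv : mu.-integrable setT (EFin \o v).
  have -> : EFin \o v = ((EFin \o (fun t => (Num.sg (sigma (clamp t)) / s)%R)) \* (EFin \o w))%E.
    by apply/funext => t /=; rewrite EFinM.
  apply: integrableMr => //; exists s^-1; split; first by rewrite num_real.
  move=> y sy x _ /=; apply: le_trans (ltW sy).
  rewrite normrM normrV ?unitfE ?gt_eqF// (gtr0_norm s0) ler_piMl ?invr_ge0 ?(ltW s0)//.
  by rewrite normr_sg; case: (_ == _).
have aevS : {ae mu, forall t, 0 <= t <= T -> v t = S t}.
  apply: filterS2 aew aeS => t wt St tT.
  by rewrite St// /v clampE// wt.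
pose Q t := (\int[mu]_(x in `[0, t]) v x)%R.
have PQ t : t <= T -> Q t = P t.
  move=> tT; apply: Rintegral_ae; apply: filterS aevS => x vS /=.
  by rewrite in_itv/= => /andP[x0 xt]; apply: vS; rewrite x0 (le_trans xt).
split.
  apply: eq_abs_continuous (abs_continuous_primitive 0 intv T) => t /andP[_ tT].
  exact: PQ.
apply: filterS3 (derivable_primitive 0 intv) aevS (filterI (ae_neq 0) (ae_neq T)).
move=> t dQ vS [tn0 tnT] /andP[t0 tT].
have {t0}t0' : 0 < t by rewrite lt_neqAle eq_sym tn0.
have {tT}tT' : t < T by rewrite lt_neqAle tnT.
have [dQt Qt] := dQ t0'.
(* The primitives agree only up to [T], so a two-sided neighbourhood requires [t < T]. *)
have nQP : {near t, Q =1 P}.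
  by near=> y; apply: PQ; apply: ltW; near: y; exact: lt_nbhsl.
split; first exact: near_eq_derivable nQP dQt.
rewrite derive1E -(near_eq_derive _ nQP) -derive1E Qt vS//.
by rewrite !ltW.
Unshelve. all: by end_near. Qed.

End NullSets.

(** * Derivatives of vector-valued functions *)

Section ColumnDerivatives.
Context {R : realType}.
Local Notation mu := (@lebesgue_measure R).

Lemma is_derive1P (W : normedModType R) (g : R -> W) (t : R) (g' : W) :
  derivable g t 1 /\ g^`()%classic t = g' <-> is_derive t 1 g g'.
Proof.
by split=> [[dg <-]|[dg <-]]; [apply: DeriveDef; rewrite ?derive1E|rewrite derive1E].
Qed.

Lemma is_derive_colP (k : nat) (g : R -> 'cV[R]_k) (t : R) (g' : 'cV[R]_k) :
  is_derive t 1 g g' <-> forall i, is_derive t 1 (fun u => g u i 0) (g' i 0).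
Proof.
split=> [[dg <-] i|dg].
  have /derivable_mxP dg' := dg.
  by apply: DeriveDef; [exact: dg'|rewrite derive_mx// mxE].
have dg1 : derivable g t 1.
  by apply/derivable_mxP => i j; rewrite (ord1 j); have [] := dg i.
apply: DeriveDef => //; rewrite derive_mx//; apply/colP => i; rewrite mxE.
by have [_ ->] := dg i.
Qed.

Lemma is_derive_mulmx (k l : nat) (A : 'M[R]_(k, l)) (g : R -> 'cV[R]_l) (t : R)
    (g' : 'cV[R]_l) :
  is_derive t 1 g g' -> is_derive t 1 (fun u => A *m g u) (A *m g').
Proof.
move=> /is_derive_colP dg; apply/is_derive_colP => i.
have -> : (fun u => (A *m g u) i 0) = \sum_j (A i j *: (fun u => g u j 0)).
  by apply/funext => u; rewrite mxE fct_sumE.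
by rewrite mxE; apply: is_derive_sum.
Qed.

Lemma is_derive_col_mx (k l : nat) (g1 : R -> 'cV[R]_k) (g2 : R -> 'cV[R]_l)
    (t : R) (g1' : 'cV[R]_k) (g2' : 'cV[R]_l) :
  is_derive t 1 (fun u => col_mx (g1 u) (g2 u)) (col_mx g1' g2') <->
  is_derive t 1 g1 g1' /\ is_derive t 1 g2 g2'.
Proof.
split=> [/is_derive_colP dg|[/is_derive_colP d1 /is_derive_colP d2]].
  split; apply/is_derive_colP => i.
    have := dg (lshift l i); rewrite col_mxEu.
    by under eq_fun do rewrite col_mxEu.
  have := dg (rshift k i); rewrite col_mxEd.
  by under eq_fun do rewrite col_mxEd.
apply/is_derive_colP => i; case: (split_ordP i) => j ->.
  by rewrite col_mxEu; under eq_fun do rewrite col_mxEu.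
by rewrite col_mxEd; under eq_fun do rewrite col_mxEd.
Qed.

Lemma near_is_derive (W : normedModType R) (f g : R -> W) (t : R) (g' : W) :
  {near t, f =1 g} -> is_derive t 1 f g' -> is_derive t 1 g g'.
Proof.
move=> fg [df <-]; apply: DeriveDef; first exact: near_eq_derivable fg df.
exact/esym/near_eq_derive.
Qed.

Lemma is_derive_eq_itv (W : normedModType R) (f g : R -> W) (b c t : R) (g' : W) :
  (forall u, b <= u <= c -> f u = g u) -> b < t < c ->
  is_derive t 1 f g' -> is_derive t 1 g g'.
Proof.
move=> fg /andP[bt tc]; apply: near_is_derive; near=> u; apply: fg.
by apply/andP; split; apply: ltW; near: u; [exact: lt_nbhsr|exact: lt_nbhsl].
Unshelve. all: by end_near. Qed.

(** The endpoints form a null set, so differentiation can take place in the open interval, where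
    only values on [[b, c]] matter. *)
Lemma ae_interior (b c : R) (P : R -> Prop) :
  {ae mu, forall t, b < t < c -> P t} -> {ae mu, forall t, b <= t <= c -> P t}.
Proof.
move=> aeP; apply: filterS3 aeP (ae_neq b) (ae_neq c) => t Pt tb tc /andP[bt tc'].
by apply: Pt; rewrite !lt_neqAle eq_sym tb tc bt.
Qed.

Lemma ae_itv_exists (b c : R) (P : R -> Prop) : b < c ->
  {ae mu, forall t, b <= t <= c -> P t} -> exists2 t, b <= t <= c & P t.
Proof.
move=> bc aeP; apply: contrapT => nP.
have nI : mu.-negligible `[b, c]%classic.
  apply: negligibleS aeP => t /=; rewrite in_itv/= => tbc /(_ tbc) Pt.
  by apply: nP; exists t.
have I0 : mu `[b, c]%classic = 0%E.
  by apply: measure_negligible nI; exact: measurable_itv.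
move: I0; rewrite [LHS]lebesgue_measure_itv/= lte_fin bc => /eqP.
by rewrite -EFinD eqe subr_eq0 gt_eqF.
Qed.

Lemma abs_continuous_col_cst_eq (k : nat) (b c : R) (g : R -> 'cV[R]_k) :
  abs_continuous b c g ->
  {ae mu, forall t, b <= t <= c -> is_derive t 1 g 0} ->
  forall t, b <= t <= c -> g t = g b.
Proof.
move=> /abs_continuous_colP acg dg t tbc; apply/colP => i.
apply: (abs_continuous_cst_eq (acg i)) => //.
apply: filterS dg => u /[apply] /is_derive_colP/(_ i); rewrite mxE.
by move=> /is_derive1P.
Qed.

Lemma forall_fin_ae (I : finType) (P : I -> R -> Prop) :
  (forall i, {ae mu, forall t, P i t}) -> {ae mu, forall t, forall i, P i t}.
Proof. by move=> aeP; exact: filter_forall. Qed.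

End ColumnDerivatives.

(** * The decomposition of the stress space *)

Section LinearAlgebra.
Context {R : realType}.

(** [kermx] is the left kernel, hence the transposes. *)
Lemma unitmx_ker0 (n : nat) (A : 'M[R]_n) :
  (forall w : 'cV[R]_n, A *m w = 0 -> w = 0) -> A \in unitmx.
Proof.
move=> kA; rewrite -unitmx_tr -row_free_unit -kermx_eq0; apply/eqP/row_matrixP => i.
rewrite row0; apply: trmx_inj; rewrite trmx0; apply: kA.
by apply: trmx_inj; rewrite trmx_mul trmxK -row_mul mulmx_ker row0 trmx0.
Qed.

Lemma mulmx_full_col_inj (m b : nat) (B : 'M[R]_(m, b)) (w : 'cV[R]_b) :
  \rank B = b -> B *m w = 0 -> w = 0.
Proof.
move=> rB Bw; have rf : row_free B^T by rewrite /row_free mxrank_tr rB.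
by apply: trmx_inj; apply: (row_free_inj rf); rewrite -trmx_mul Bw !trmx0 mul0mx.
Qed.

Lemma mulmx_tr_eq0 (n : nat) (v : 'cV[R]_n) : v^T *m v = 0 -> v = 0.
Proof.
move=> /matrixP/(_ 0 0); rewrite !mxE => /eqP.
rewrite psumr_eq0 => [/allP v0|i _]; last by rewrite mxE -expr2 sqr_ge0.
apply/colP => i; have := v0 i (mem_index_enum i); rewrite !mxE -expr2.
by rewrite sqrf_eq0 => /eqP.
Qed.

Section Decomposition.
Variables (N m q : nat) (D : 'M[R]_(m, N)) (Rd : 'M[R]_(q, N)) (k : 'I_m -> R).
Variables (dimU dimV : nat) (U : 'M[R]_(m, dimU)) (V : 'M[R]_(m, dimV)).
Let K := diag_mx (\row_i k i).
Hypothesis k0 : forall i, 0 < k i.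

Lemma diag_pos_unitmx : K \in unitmx.
Proof.
rewrite unitmxE det_diag unitfE prodf_seq_neq0; apply/allP => i _ /=.
by rewrite mxE gt_eqF.
Qed.

Lemma invmx_diagE : invmx K = diag_mx (\row_i (k i)^-1).
Proof.
apply: (can_inj (mulKmx diag_pos_unitmx)); rewrite mulmxV ?diag_pos_unitmx//.
rewrite mulmx_diag; apply/matrixP => i j; rewrite !mxE.
by case: eqVneq => // ->; rewrite mulfV ?gt_eqF.
Qed.

Lemma tr_invmx_diag : (invmx K)^T = invmx K.
Proof. by rewrite invmx_diagE tr_diag_mx. Qed.

Lemma invmx_diag_form_eq0 (v : 'cV[R]_m) : v^T *m invmx K *m v = 0 -> v = 0.
Proof.
rewrite invmx_diagE => /matrixP/(_ 0 0); rewrite mxE.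
rewrite mul_mx_diag [RHS]mxE => /eqP.
under eq_bigr do rewrite !mxE mulrAC -expr2.
rewrite psumr_eq0 => [/allP v0|i _]; last by rewrite mulr_ge0 ?sqr_ge0 ?invr_ge0 ?(ltW (k0 i)).
apply/colP => i; have := v0 i (mem_index_enum i); rewrite mxE mulf_eq0.
by rewrite sqrf_eq0 invr_eq0 (gt_eqF (k0 i)) orbF => /eqP.
Qed.

Section ProjCoef.
Variables (b : nat) (B : 'M[R]_(m, b)).
Hypothesis rB : \rank B = b.

Lemma gram_unitmx : B^T *m invmx K *m B \in unitmx.
Proof.
apply: unitmx_ker0 => w Gw; apply: (mulmx_full_col_inj rB).
apply: invmx_diag_form_eq0; rewrite trmx_mul.
by rewrite -!mulmxA; move: Gw; rewrite -!mulmxA => ->; rewrite mulmx0.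
Qed.

Lemma proj_coefK : proj_coef K B *m B = 1%:M.
Proof. by rewrite /proj_coef -!mulmxA mulVmx// !mulmxA gram_unitmx. Qed.

(** These normal equations identify [B *m proj_coef K B] as the projection onto the columns of [B]
    that is orthogonal for [K^-1]. *)
Lemma proj_coef_orth (z : 'cV[R]_m) :
  B^T *m invmx K *m (z - B *m (proj_coef K B *m z)) = 0.
Proof.
rewrite /proj_coef mulmxBr (mulmxA _ B) -!(mulmxA (invmx (_ *m B))).
by rewrite mulKVmx ?gram_unitmx// subrr.
Qed.

Lemma proj_coef_eq0 (z : 'cV[R]_m) :
  B^T *m invmx K *m z = 0 -> proj_coef K B *m z = 0.
Proof. by move=> Bz; rewrite /proj_coef -!(mulmxA (invmx (_ *m B))) Bz mulmx0. Qed.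

End ProjCoef.

Lemma proj_coef_range (b : nat) (B : 'M[R]_(m, b)) (A : set 'cV[R]_m) (z : 'cV[R]_m) :
  is_basis_of B A -> A z -> B *m (proj_coef K B *m z) = z.
Proof.
by move=> [rB ->] [w _ <-]; rewrite (mulmxA _ B) proj_coefK// mul1mx.
Qed.

Lemma is_basis_of_mem (b : nat) (B : 'M[R]_(m, b)) (A : set 'cV[R]_m) (w : 'cV[R]_b) :
  is_basis_of B A -> A (B *m w).
Proof. by move=> [_ ->]; exists w. Qed.

Hypothesis rRd : \rank Rd = q.

Lemma gram_rows_unitmx : Rd *m Rd^T \in unitmx.
Proof.
apply: unitmx_ker0 => w Rw; apply: (@mulmx_full_col_inj _ _ Rd^T); first by rewrite mxrank_tr.
by apply: mulmx_tr_eq0; rewrite trmx_mul trmxK -mulmxA (mulmxA Rd) Rw mulmx0.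
Qed.

Lemma mul_rpinv : Rd *m rpinv Rd = 1%:M.
Proof. by rewrite /rpinv mulmxA mulmxV// gram_rows_unitmx. Qed.

(** With the least squares multiplier [l], the residual lies in the kernel of [Rd]; it is then
    orthogonal to [g] and to the image of [Rd^T], hence to itself. *)
Lemma range_tr_orth_ker (g : 'cV[R]_N) :
  (forall w : 'cV[R]_N, Rd *m w = 0 -> w^T *m g = 0) ->
  range (fun l : 'cV[R]_q => Rd^T *m l) g.
Proof.
move=> orth; pose l := invmx (Rd *m Rd^T) *m (Rd *m g); exists l => //.
have Rw : Rd *m (g - Rd^T *m l) = 0.
  by rewrite mulmxBr mulmxA /l mulmxA mulmxV ?gram_rows_unitmx// mul1mx subrr.
apply/eqP; rewrite eq_sym -subr_eq0; apply/eqP/mulmx_tr_eq0.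
rewrite mulmxBr orth// mulmxA -trmx_mul.
by rewrite Rw trmx0 mul0mx subrr.
Qed.

Lemma space_V_lin (c : R) (u v : 'cV[R]_m) :
  space_V D Rd u -> space_V D Rd v -> space_V D Rd (c *: u + v).
Proof.
move=> [l1 _ E1] [l2 _ E2]; exists (c *: l1 + l2) => //.
by rewrite !mulmxDr -!scalemxAr E1 E2.
Qed.

(** Virtual work: the stiffness cancels against [K^-1], and [D^T v], a reaction in the image of
    [Rd^T], does no work on a displacement in the kernel of [Rd]. *)
Lemma space_V_orth_U (u v : 'cV[R]_m) : space_U K D Rd u -> space_V D Rd v ->
  v^T *m invmx K *m u = 0.
Proof.
move=> [w /= Rw <-] [l _ Rl].
rewrite -!mulmxA (mulmxA (invmx K)) mulVmx ?diag_pos_unitmx// mul1mx.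
rewrite mulmxA -{1}(trmxK D) -trmx_mul -Rl trmx_mul trmxK.
by rewrite -mulmxA Rw mulmx0.
Qed.

Hypotheses (bU : is_basis_of U (space_U K D Rd)) (bV : is_basis_of V (space_V D Rd)).
Let pU (z : 'cV[R]_m) := U *m (proj_coef K U *m z).
Let pV (z : 'cV[R]_m) := V *m (proj_coef K V *m z).

(** For [w] in the kernel of [Rd], [D *m w] is [K^-1] times a combination of columns of [U], and the
    residual is orthogonal to these for [K^-1]. *)
Lemma proj_U_compl (z : 'cV[R]_m) : space_V D Rd (z - pU z).
Proof.
apply: range_tr_orth_ker => w Rw.
have [v Uv] : exists v, U *m v = K *m D *m w.
  have : space_U K D Rd (K *m D *m w) by exists w.
  by rewrite bU.2 => -[v _ <-]; exists v.
rewrite mulmxA -trmx_mul.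
have -> : D *m w = invmx K *m (U *m v).
  by rewrite Uv -!mulmxA mulKmx// diag_pos_unitmx.
rewrite !trmx_mul tr_invmx_diag -!mulmxA.
by rewrite [X in v^T *m X]mulmxA proj_coef_orth ?bU.1// mulmx0.
Qed.

Lemma proj_V_id (v : 'cV[R]_m) : space_V D Rd v -> pV v = v.
Proof. exact: proj_coef_range bV. Qed.

Lemma proj_V_U (u : 'cV[R]_m) : space_U K D Rd u -> pV u = 0.
Proof.
move=> Uu; rewrite /pV proj_coef_eq0 ?mulmx0//.
apply/row_matrixP => i; rewrite row0 row_mul row_mul -tr_col.
by apply: space_V_orth_U => //; rewrite colE; exact: is_basis_of_mem bV.
Qed.

Lemma proj_UV (z : 'cV[R]_m) : z = pU z + pV z.
Proof.
have -> : pV z = z - pU z.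
  rewrite -[RHS]proj_V_id; last exact: proj_U_compl.
  rewrite /pV !mulmxBr -/(pV z) -/(pV (pU z)) (proj_V_U (u := pU z)) ?subr0//.
  exact: is_basis_of_mem bU.
by rewrite subrKC.
Qed.

Lemma proj_U_V (v : 'cV[R]_m) : space_V D Rd v -> pU v = 0.
Proof.
by move=> Vv; have := proj_UV v; rewrite proj_V_id// => /esym/(canRL (addrK _)); rewrite subrr.
Qed.

Hypothesis kerDR : forall w : 'cV[R]_N, D *m w = 0 -> Rd *m w = 0 -> w = 0.

Lemma pinv_gram_unitmx : D^T *m D + Rd^T *m Rd \in unitmx.
Proof.
apply: unitmx_ker0 => w Mw.
have : (col_mx (D *m w) (Rd *m w))^T *m col_mx (D *m w) (Rd *m w) = 0.
  rewrite tr_col_mx mul_row_col !trmx_mul -!mulmxA -mulmxDr.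
  by rewrite (mulmxA D^T) (mulmxA Rd^T) -mulmxDl Mw mulmx0.
move=> /mulmx_tr_eq0/eqP; rewrite col_mx_eq0 => /andP[/eqP ? /eqP ?].
exact: kerDR.
Qed.

Lemma pinv_compatibilityK (z : 'cV[R]_N) :
  pinv_compatibility D Rd *m col_mx (D *m z) (Rd *m z) = z.
Proof.
rewrite /pinv_compatibility -mulmxA mul_row_col (mulmxA D^T) (mulmxA Rd^T).
by rewrite -mulmxDl mulKmx// pinv_gram_unitmx.
Qed.

(** Adding [rpinv Rd *m (Rd *m xi0 + r)] to an admissible [z] gives an element of the kernel of
    [Rd]. Compatibility thus says that [K] times the correspondingly shifted elongation lies in the
    space spanned by [U], that is, has zero projection [pV]. *)
Lemma compatibleP (xi0 : 'cV[R]_N) (r : 'cV[R]_q) (sigma p : 'cV[R]_m) :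
  let G := V *m proj_coef K V *m K *m D *m rpinv Rd in
  (exists z : 'cV[R]_N, D *m z = invmx K *m sigma + p /\ Rd *m (xi0 + z) + r = 0) <->
  pV sigma + pV (K *m p) + G *m r = - (G *m (Rd *m xi0)).
Proof.
move=> G; set y := Rd *m xi0.
have KxE : K *m (invmx K *m sigma + p) = sigma + K *m p.
  by rewrite mulmxDr mulKVmx// diag_pos_unitmx.
have GE c : G *m c = pV (K *m (D *m (rpinv Rd *m c))) by rewrite /G /pV !mulmxA.
have pVD a b : pV (a + b) = pV a + pV b by rewrite /pV !mulmxDr.
split=> [[z [Dz Rz]]|E].
  have Uz : space_U K D Rd (K *m D *m (z + rpinv Rd *m (y + r))).
    exists (z + rpinv Rd *m (y + r)) => //=.
    by rewrite (mulmxDr Rd) (mulmxA Rd) mul_rpinv mul1mx addrA -mulmxDr (addrC z).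
  move: (proj_V_U Uz); rewrite -mulmxA (mulmxDr D) Dz (mulmxDr K) KxE.
  rewrite -/(pV _) !pVD -GE (mulmxDr G) addrCA addrC => /(canRL (addrK _)).
  by rewrite sub0r.
have : pV (K *m (invmx K *m sigma + p + D *m (rpinv Rd *m (y + r)))) = 0.
  by rewrite (mulmxDr K) KxE !pVD -GE (mulmxDr G) addrCA addrC E addNr.
set z := K *m _ => pz; have : space_U K D Rd z.
  by rewrite (proj_UV z) -/(pV z) pz addr0; exact: is_basis_of_mem bU.
move=> [w /= Rw]; rewrite /z -mulmxA => /(can_inj (mulKmx diag_pos_unitmx)) Dw.
exists (w - rpinv Rd *m (y + r)); split; first by rewrite mulmxBr Dw addrK.
rewrite (mulmxDr Rd) (mulmxBr Rd) Rw sub0r (mulmxA Rd) mul_rpinv mul1mx -/y.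
by rewrite opprD addrA subrr sub0r addNr.
Qed.

End Decomposition.

End LinearAlgebra.

(** * Normality conditions *)

Section NormalCones.
Context {R : realType} {m : nat}.
Variables (s c0 : 'I_m -> R).
Let C := elastic_set c0 s.

Lemma elastic_set_col (sigma alpha : 'cV[R]_m) :
  C (col_mx sigma alpha) <-> forall i, `|sigma i 0| <= c0 i + s i * alpha i 0.
Proof.
rewrite /C /elastic_set /= col_mxKu col_mxKd.
split=> H i; have := H i; first by move=> [? ?]; rewrite ler_norml; apply/andP.
by rewrite ler_norml => /andP[].
Qed.

Lemma translate_col (A : set 'cV[R]_(m + m)) (v1 v2 z1 z2 : 'cV[R]_m) :
  translate A (col_mx v1 v2) (col_mx z1 z2) <-> A (col_mx (z1 - v1) (z2 - v2)).
Proof.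
split=> [[z Az E]|Az].
  by rewrite -add_col_mx -opp_col_mx -E addrK.
by exists (col_mx (z1 - v1) (z2 - v2)); rewrite // add_col_mx !subrK.
Qed.

(* The normality condition of both problems in increments (v, beta) from
   (sigma, alpha), the increments v being restricted to W. *)
Definition normal_rates (W : set 'cV[R]_m) (g b sigma alpha : 'cV[R]_m) : Prop :=
  C (col_mx sigma alpha) /\
  forall v beta, W v -> C (col_mx (sigma + v) (alpha + beta)) ->
    (g^T *m v) 0 0 <= (b^T *m beta) 0 0.

(** The translation by [ha] is absorbed in [a - ha], and the minus sign before [b] carries the
    second half of the scalar product to the right-hand side. *)
Lemma lattice_normal_coneP (ha sigma a g b : 'cV[R]_m) :
  normal_cone 1%:M (translate C (col_mx 0 ha)) (col_mx sigma a) (col_mx g (- b)) <->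
  normal_rates setT g b sigma (a - ha).
Proof.
rewrite /normal_cone /normal_rates /= translate_col subr0.
split=> -[Cs H]; split => //.
  move=> v beta _ Cv.
  have := H (col_mx (sigma + v) (a + beta)); rewrite translate_col subr0 addrAC.
  move=> /(_ Cv); rewrite mulmx1 opp_col_mx add_col_mx !(addrAC _ _ (- _)) !subrr !add0r.
  by rewrite tr_col_mx mul_row_col linearN/= mulNmx mxE [X in _ + X]mxE subr_le0.
move=> c; rewrite -[c]vsubmxK; move: (usubmx c) (dsubmx c) => c1 c2.
rewrite translate_col subr0 => Cc.
rewrite mulmx1 opp_col_mx add_col_mx tr_col_mx mul_row_col linearN/= mulNmx.
rewrite mxE [X in _ + X]mxE subr_le0; apply: H => //.
by rewrite subrKC addrC addrA subrK.
Qed.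

(** As [V] is stable under sums and opposites and [y] lies in it, restricting points to [V]
    restricts increments to [V]. The metric makes [- (invmx K *m dy)] play the role of the plastic
    rate. *)
Lemma sweeping_normal_coneP (K : 'M[R]_m) (V : set 'cV[R]_m)
    (w ha y a dy da : 'cV[R]_m) : K \in unitmx -> (invmx K)^T = invmx K ->
  (forall u v, V u -> V v -> V (u + v)) -> (forall v, V v -> V (- v)) ->
  normal_cone (invmx (block_mx K 0 0 1%:M))
    (translate C (col_mx w ha) `&` [set z | V (usubmx z)]) (col_mx y a)
    (- col_mx dy da) <->
  V y /\ normal_rates V (- (invmx K *m dy)) da (y - w) (a - ha).
Proof.
move=> uK trK VD VN.
have -> : invmx (block_mx K 0 0 1%:M) = block_mx (invmx K) 0 0 (1%:M : 'M[R]_m).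
  have uB : block_mx K 0 0 (1%:M : 'M[R]_m) \in unitmx.
    by rewrite unitmxE det_ublock det1 mulr1 -unitmxE.
  apply: (can_inj (mulKmx uB)); rewrite mulmxV// mulmx_block.
  by rewrite !mulmx0 !mul0mx !addr0 !add0r mulmxV// mul1mx -scalar_mx_block.
have formE (u1 u2 : 'cV[R]_m) :
    ((- col_mx dy da)^T *m block_mx (invmx K) 0 0 1%:M *m col_mx u1 u2) 0 0 =
    ((- (invmx K *m dy))^T *m u1) 0 0 - (da^T *m u2) 0 0.
  rewrite -mulmxA mul_block_col !mul0mx add0r addr0 mul1mx opp_col_mx tr_col_mx.
  rewrite mul_row_col mxE !linearN/= !mulNmx trmx_mul trK mulmxA.
  by rewrite [X in _ + X]mxE.
have subE (u1 u2 v1 v2 : 'cV[R]_m) :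
    col_mx u1 u2 - col_mx v1 v2 = col_mx (u1 - v1) (u2 - v2).
  by rewrite opp_col_mx add_col_mx.
rewrite /normal_cone /normal_rates /= translate_col col_mxKu.
split=> [[[Cy Vy] H]|[Vy [Cy H]]]; split => //.
  split => // v beta Vv Cv; rewrite -subr_le0 -formE.
  have := H (col_mx (y + v) (a + beta)); rewrite translate_col col_mxKu.
  rewrite (addrAC y) (addrAC a) => /(_ (conj Cv (VD _ _ Vy Vv))).
  by rewrite subE !(addrAC _ _ (- _)) !subrr !add0r.
move=> c; rewrite -[c]vsubmxK; move: (usubmx c) (dsubmx c) => c1 c2.
rewrite translate_col col_mxKu => -[Cc Vc].
rewrite subE formE subr_le0; apply: H.
  by apply: VD => //; exact: VN.
have addE (u1 u2 v1 : 'cV[R]_m) : u1 - v1 + (u2 - u1) = u2 - v1.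
  by rewrite addrC addrA subrK.
by rewrite !addE.
Qed.

Lemma normal_ratesW (W : set 'cV[R]_m) (g g' b sigma alpha : 'cV[R]_m) :
  (forall v, W v -> g'^T *m v = g^T *m v) ->
  normal_rates setT g b sigma alpha -> normal_rates W g' b sigma alpha.
Proof.
move=> gg [Cs H]; split => // v beta Wv Cv; rewrite gg//.
exact: H.
Qed.

Hypothesis s0 : forall i, 0 < s i.

(** The plastic strain rate that the flow rule assigns to the hardening rate [b]. *)
Definition sign_rate (sigma b : 'cV[R]_m) : 'cV[R]_m :=
  \col_i (Num.sg (sigma i 0) / s i * b i 0).

(* With [sigma_i <> 0] wherever [b_i <> 0], the boundary of the yield domain is
   smooth in the relevant directions, so increments along it of both signs are
   admissible and normality becomes an equality. *)
Lemma normal_rates_sign (W : set 'cV[R]_m) (g b sigma alpha : 'cV[R]_m) :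
  (forall c v, W v -> W (c *: v)) -> W 0 ->
  (forall i, c0 i + s i * alpha i 0 = 0 -> b i 0 = 0) ->
  normal_rates W g b sigma alpha ->
  [/\ (forall i, 0 <= b i 0),
      (forall i, b i 0 != 0 -> `|sigma i 0| = c0 i + s i * alpha i 0) &
      (forall v, W v -> (g^T *m v) 0 0 = ((sign_rate sigma b)^T *m v) 0 0)].
Proof.
move=> WZ W0 apex [/elastic_set_col Cs H].
(* Increasing a single [alpha_i] is always admissible. *)
have b0 i : 0 <= b i 0.
  have := H 0 (delta_mx i 0) W0; rewrite mulmx0 mxE -colE !mxE; apply.
  apply/elastic_set_col => j; rewrite !mxE addr0; apply: le_trans (Cs j) _.
  by rewrite lerD2l ler_pM2l// lerDl.
(* The test increment lowers every [alpha_j] until its constraint is an equality; a sum of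
   nonnegative terms is then at most zero. *)
have act i : b i 0 != 0 -> `|sigma i 0| = c0 i + s i * alpha i 0.
  pose u i := c0 i + s i * alpha i 0.
  have u0 j : 0 <= b j 0 * ((u j - `|sigma j 0|) / s j).
    by rewrite mulr_ge0// mulr_ge0 ?invr_ge0 ?(ltW (s0 _))// subr_ge0.
  have := H 0 (\col_j ((`|sigma j 0| - u j) / s j)) W0; rewrite mulmx0 [leLHS]mxE.
  have CC : C (col_mx (sigma + 0) (alpha + \col_j ((`|sigma j 0| - u j) / s j))).
    apply/elastic_set_col => j; rewrite !mxE addr0 mulrDr mulrCA mulfV ?gt_eqF//.
    by rewrite mulr1 addrA subrKC.
  move=> /(_ CC); rewrite mxE.
  rewrite (eq_bigr (fun j => - (b j 0 * ((u j - `|sigma j 0|) / s j)))); last first.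
    by move=> j _; rewrite !mxE -mulrN -mulNr opprB.
  rewrite sumrN oppr_ge0 => sum0 bi.
  have /eqP : \sum_j b j 0 * ((u j - `|sigma j 0|) / s j) = 0.
    by apply/le_anti; rewrite sum0 sumr_ge0.
  rewrite psumr_eq0// => /allP /(_ i (mem_index_enum i)) /=.
  rewrite mulf_eq0 (negPf bi)/= mulf_eq0 invr_eq0 (gt_eqF (s0 i)) orbF subr_eq0.
  by move=> /eqP.
split => //.
have le_v v : W v -> (g^T *m v) 0 0 <= ((sign_rate sigma b)^T *m v) 0 0.
  (* Division by [M] makes [v] too small to reverse the sign of [sigma_i] at any [i] with [b_i]
     nonzero, where [apex] excludes [sigma_i = 0]. Terms with [sigma_i = 0] are zero by the
     convention for inverses. *)
  move=> Wv; pose M := 1 + \sum_i (`|v i 0| / `|sigma i 0|).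
  have M0 : 0 < M by rewrite ltr_pwDl// sumr_ge0// => i _; rewrite divr_ge0.
  have small i : b i 0 != 0 -> `|M^-1 * v i 0| <= `|sigma i 0|.
    move=> bi; have si : 0 < `|sigma i 0|.
      rewrite lt_neqAle normr_ge0 andbT eq_sym act//.
      by apply: contraNneq bi => /apex ->.
    rewrite normrM ger0_norm ?invr_ge0 ?(ltW M0)// mulrC ler_pdivrMr//.
    rewrite mulrC -ler_pdivrMr// /M (bigD1 i)//= addrCA lerDl.
    by rewrite addr_ge0// sumr_ge0// => j _; rewrite divr_ge0.
  (* Where [b_i] is nonzero the increment follows the face of the yield domain exactly; elsewhere
     [alpha_i] grows enough to admit either sign of [v_i], at no cost. *)
  pose beta := \col_i (if b i 0 != 0 then Num.sg (sigma i 0) * (M^-1 * v i 0) / s i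
                       else `|M^-1 * v i 0| / s i) : 'cV[R]_m.
  have Cb : C (col_mx (sigma + M^-1 *: v) (alpha + beta)).
    apply/elastic_set_col => i; rewrite !mxE mulrDr addrA.
    case: ifPn => [bi|_]; rewrite [s i * (_ / _)]mulrC divfK ?gt_eqF//.
      have := small i bi; rewrite -(act i bi); move: (M^-1 * v i 0) => x.
      case: (sgrP (sigma i 0)) => [->|sp|sn] xs.
      - by move: xs; rewrite ?normr0 normr_le0 => /eqP ->; rewrite addr0 mulr0 normr0 addr0.
      - move: xs; rewrite ?(gtr0_norm sp) ler_norml mul1r => /andP[? ?].
        by rewrite ger0_norm; lra.
      - move: xs; rewrite ?(ltr0_norm sn) ler_norml mulN1r => /andP[? ?].
        by rewrite ler0_norm; lra.
    by apply: le_trans (ler_normD _ _) _; rewrite lerD2r.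
  have := H (M^-1 *: v) beta (WZ _ _ Wv) Cb.
  rewrite -scalemxAr mxE.
  have -> : (b^T *m beta) 0 0 = M^-1 * ((sign_rate sigma b)^T *m v) 0 0.
    rewrite !mxE mulr_sumr; apply: eq_bigr => i _; rewrite !mxE.
    case: ifPn => [_|]; first by field; rewrite !gt_eqF.
    by rewrite negbK => /eqP ->; rewrite !(mul0r, mulr0).
  by rewrite ler_pM2l ?invr_gt0.
(* The reverse inequality is [le_v] for [- v]. *)
move=> v Wv; apply/le_anti; rewrite le_v//=.
have := le_v _ (WZ (-1) v Wv).
by rewrite -!scalemxAr !mxE !mulN1r lerN2.
Qed.

(** Convexity of the absolute value: at an active spring [sg(sigma) v <= |sigma + v| - |sigma| <= s
    beta]; the other springs contribute zero to both sides. *)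
Lemma sign_normal_rates (sigma b alpha : 'cV[R]_m) :
  C (col_mx sigma alpha) -> (forall i, 0 <= b i 0) ->
  (forall i, b i 0 != 0 -> `|sigma i 0| = c0 i + s i * alpha i 0) ->
  normal_rates setT (sign_rate sigma b) b sigma alpha.
Proof.
move=> Cs b0 act; split => // v beta _ /elastic_set_col Cv.
rewrite !mxE; apply: ler_sum => i _; rewrite !mxE.
have [->|bi] := eqVneq (b i 0) 0; first by rewrite mulr0 !mul0r.
rewrite mulrAC mulrC ler_wpM2l// mulrAC ler_pdivrMr//.
have := Cv i; rewrite !mxE mulrDr addrA -(act _ bi).
move: (sigma i 0) (v i 0) (beta i 0) => x w be.
case: sgrP => [->|x0|x0]; rewrite ?normr0 ?mul0r ?mul1r ?mulN1r.
- by move=> h; have := le_trans (normr_ge0 _) h; lra.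
- by rewrite ler_norml ?(gtr0_norm x0) => /andP[? ?]; lra.
- by rewrite ler_norml ?(ltr0_norm x0) => /andP[? ?]; lra.
Qed.

End NormalCones.

(** * Lattice problem and sweeping process *)

Section Equivalence.
Context {R : realType}.
Local Notation mu := (@lebesgue_measure R).
Variables (N m q : nat) (T : R) (D : 'M[R]_(m, N)) (Rd : 'M[R]_(q, N)).
Variables (xi0 : 'cV[R]_N) (r : R -> 'cV[R]_q) (f : R -> 'cV[R]_N).
Variables (k h s c0 : 'I_m -> R).
Variables (dimU dimV : nat) (U : 'M[R]_(m, dimU)) (V : 'M[R]_(m, dimV)).
Let K := diag_mx (\row_i k i).
Let H := diag_mx (\row_i h i).
Let C := elastic_set c0 s.
Let F1 := usubmx (pinv_equilibrium D Rd).
Let G := V *m proj_coef K V *m K *m D *m rpinv Rd.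
Let F := U *m proj_coef K U *m F1.
Let KK := block_mx K 0 0 1%:M : 'M[R]_(m + m).
Let CC (t : R) (a : 'cV[R]_m) :=
  translate C (col_mx (G *m r t - F *m f t) (H *m a))
  `&` [set z | space_V D Rd (usubmx z)].
Hypotheses (T0 : 0 < T) (k0 : forall i, 0 < k i) (c00 : forall i, 0 < c0 i).
Hypotheses (bU : is_basis_of U (space_U K D Rd))
  (bV : is_basis_of V (space_V D Rd)).
Hypothesis rRd : \rank Rd = q.
Hypothesis kerDR : forall w : 'cV[R]_N, D *m w = 0 -> Rd *m w = 0 -> w = 0.
Hypotheses (acr : abs_continuous 0 T r) (acf : abs_continuous 0 T f).

Let PU := U *m proj_coef K U.
Let PV := V *m proj_coef K V.
Let uK : K \in unitmx := diag_pos_unitmx k0.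

Let PVE (z : 'cV[R]_m) : V *m (proj_coef K V *m z) = PV *m z.
Proof. by rewrite mulmxA. Qed.

Let PUE (z : 'cV[R]_m) : U *m (proj_coef K U *m z) = PU *m z.
Proof. by rewrite mulmxA. Qed.

Let projUV (z : 'cV[R]_m) : z = PU *m z + PV *m z.
Proof. by rewrite -PVE -PUE; exact: (proj_UV k0 rRd bU bV). Qed.

Let memV (w : 'cV[R]_dimV) : space_V D Rd (V *m w).
Proof. exact: is_basis_of_mem bV. Qed.

Let memU (w : 'cV[R]_dimU) : space_U K D Rd (U *m w).
Proof. exact: is_basis_of_mem bU. Qed.

Let space_VD (u v : 'cV[R]_m) :
  space_V D Rd u -> space_V D Rd v -> space_V D Rd (u + v).
Proof. by move=> Vu Vv; rewrite -[u]scale1r; exact: space_V_lin. Qed.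

Let space_V0 : space_V D Rd 0.
Proof. by exists 0 => //; rewrite !mulmx0. Qed.

Let space_VZ c (v : 'cV[R]_m) : space_V D Rd v -> space_V D Rd (c *: v).
Proof. by move=> Vv; rewrite -[_ *: _]addr0; exact: space_V_lin. Qed.

Let space_VN (v : 'cV[R]_m) : space_V D Rd v -> space_V D Rd (- v).
Proof. by rewrite -scaleN1r; exact: space_VZ. Qed.

Let stress_balanceE (sigma : 'cV[R]_m) (t : R) :
  range (fun l : 'cV[R]_q => Rd^T *m l) (D^T *m (- sigma + F1 *m f t)) =
  space_V D Rd (F1 *m f t - sigma).
Proof. by rewrite addrC. Qed.

Let CC_coneP (t : R) (y a dy da : 'cV[R]_m) :
  normal_cone (invmx KK) (CC t a) (col_mx y a) (- col_mx dy da) <->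
  space_V D Rd y /\ normal_rates s c0 (space_V D Rd) (- (invmx K *m dy)) da
    (y - (G *m r t - F *m f t)) (a - H *m a).
Proof.
apply: sweeping_normal_coneP => //.
exact: tr_invmx_diag.
Qed.

(** * From the lattice problem to the sweeping process *)

Section FromLattice.
Variables (x eps p sigma a y : R -> 'cV[R]_m) (zeta : R -> 'cV[R]_N).
Hypothesis lp : lattice_problem T D Rd xi0 K H C F1 r f x eps p sigma a zeta.
Hypothesis yE : forall t, 0 <= t <= T -> y t = sigma t + G *m r t - F *m f t.

Let eps_sigma t : 0 <= t <= T -> eps t = invmx K *m sigma t.
Proof. by case: lp => _ _ eqs _ /eqs[_ -> _ _ _]; rewrite mulKmx. Qed.

(** By balance of forces [F1 f - sigma] lies in [space_V], so [F f] is the [PU] component of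
    [sigma]. *)
Let y_proj t : 0 <= t <= T -> y t = PV *m sigma t + G *m r t.
Proof.
move=> tT; case: lp => _ _ /(_ _ tT)[_ _ _ _ +] _; rewrite stress_balanceE.
move=> /(proj_U_V k0 rRd bU bV); rewrite PUE mulmxBr mulmxA => /subr0_eq FE.
have {}FE : F *m f t = PU *m sigma t by exact: FE.
rewrite yE// FE addrAC; congr (_ + _).
by rewrite {1}(projUV (sigma t)) addrC addKr.
Qed.

(** Compatibility eliminates both loads, so [y] is differentiable wherever [p] is. *)
Let y_plastic t : 0 <= t <= T ->
  y t = - (G *m (Rd *m xi0)) - PV *m (K *m p t).
Proof.
move=> tT; rewrite y_proj//.
have /(compatibleP k0 rRd bU bV) : exists z : 'cV[R]_N,
    D *m z = invmx K *m sigma t + p t /\ Rd *m (xi0 + z) + r t = 0.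
  exists (zeta t); case: lp => _ _ /(_ _ tT)[xE _ -> -> _] _.
  by rewrite xE eps_sigma.
rewrite !PVE => <-.
by rewrite addrAC addrK.
Qed.

Let ac_p : abs_continuous 0 T p. Proof. by case: lp => -[]. Qed.
Let ac_a : abs_continuous 0 T a. Proof. by case: lp => _ []. Qed.
Let ac_sigma : abs_continuous 0 T sigma. Proof. by case: lp => _ []. Qed.

Lemma lattice_rates : {ae mu, forall t, 0 < t < T -> exists dp da : 'cV[R]_m,
  [/\ is_derive t 1 p dp, is_derive t 1 a da &
      normal_rates s c0 setT dp da (sigma t) (a t - H *m a t)]}.
Proof.
case: lp => _ _ _; apply: filterS => t Ht /andP[t0 tT].
have [|dz] := Ht; first by rewrite !ltW.
set z' := _^`()%classic t; rewrite -[z']vsubmxK => cone.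
have : is_derive t 1 (fun u => col_mx (p u) (- a u)) z'.
  by apply/is_derive1P; split.
rewrite -[z']vsubmxK => /is_derive_col_mx[dp dNa].
exists (usubmx z'), (- dsubmx z'); split => //.
  rewrite (_ : a = - (fun u => - a u)); first exact: is_deriveN.
  by apply/funext => u; rewrite /= opprK.
by apply/lattice_normal_coneP; rewrite opprK.
Qed.

(** [- K^-1 y'] differs from [p'] by [K^-1] times a vector of [space_U], invisible to increments in
    [space_V]. *)
Lemma lattice_sweeping : sweeping_solution T KK CC y a.
Proof.
have acy : abs_continuous 0 T y.
  apply: (@eq_abs_continuous _ _ 0 T
    (fun t => - (G *m (Rd *m xi0)) - PV *m (K *m p t))) => [t /y_plastic//|].
  apply: abs_continuousD; first exact: abs_continuous_cst.
  by apply: abs_continuousN; do 2 apply: abs_continuous_mulmx.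
split; first by apply/abs_continuous_col_mx.
apply: ae_interior; apply: filterS lattice_rates => t Ht t0T.
have tT : 0 <= t <= T by move/andP: t0T => [? ?]; rewrite !ltW.
have [dp [da [dpt dat rates]]] := Ht t0T.
pose dy := - (PV *m (K *m dp)).
have dyt : is_derive t 1 y dy.
  apply: (@is_derive_eq_itv _ _
    (fun t => - (G *m (Rd *m xi0)) - PV *m (K *m p t)) y 0 T) => //.
    by move=> u uT; rewrite y_plastic.
  rewrite -[dy]add0r; apply: is_deriveD; apply: is_deriveN.
  by do 2 apply: is_derive_mulmx.
have /is_derive1P[dz z'E] : is_derive t 1 (fun u => col_mx (y u) (a u)) (col_mx dy da).
  by apply/is_derive_col_mx.
split => //; rewrite z'E; apply/CC_coneP; split.
  rewrite y_proj//; apply: space_VD; rewrite ?/PV ?/G -!mulmxA; exact: memV.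
rewrite yE// opprB addrA subrK addrK.
apply: normal_ratesW rates => v Vv.
have -> : - (invmx K *m dy) = dp - invmx K *m (PU *m (K *m dp)).
  rewrite /dy mulmxN opprK (_ : PV *m _ = K *m dp - PU *m (K *m dp)).
    by rewrite mulmxBr mulKmx.
  by rewrite {2}(projUV (K *m dp)) addrC addKr.
rewrite linearB/= mulmxBl -[RHS]subr0; congr (_ - _).
apply: trmx_inj; rewrite trmx_mul trmxK trmx0 (mulmxA v^T).
apply: (space_V_orth_U k0 _ Vv).
by rewrite -PUE; exact: memU.
Qed.

End FromLattice.

(** * The flow rule under positive hardening *)

Section PositiveHardening.
Hypothesis s0 : forall i, 0 < s i.

(** Since [alpha_i = (1 - h i) a_i], the apex condition prescribes the value of [a_i]; the
    coefficient [s i * (1 - h i)] cannot vanish there because [c0 i] is positive. *)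
Let apex_rest (a : R -> 'cV[R]_m) :
  {ae mu, forall t, forall i, derivable (fun u => a u i 0) t 1 ->
    c0 i + s i * (a t - H *m a t) i 0 = 0 -> (fun u => a u i 0)^`()%classic t = 0}.
Proof.
apply: forall_fin_ae => i.
have := derive1_level_set (fun u => a u i 0) (- c0 i / (s i * (1 - h i))).
apply: filterS => t Ht dat; rewrite mul_diag_mx !mxE => apex; apply: Ht => //.
have apex' : s i * (1 - h i) * a t i 0 = - c0 i by lra.
have nz : s i * (1 - h i) != 0.
  apply/eqP => z; move: apex'; rewrite z mul0r => /eqP.
  by rewrite eq_sym oppr_eq0 gt_eqF.
by rewrite -apex' mulrAC mulfV// mul1r.
Qed.

Let sign_integral_derive (sigma a : R -> 'cV[R]_m) :
  abs_continuous 0 T sigma -> abs_continuous 0 T a ->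
  {ae mu, forall t, 0 < t < T -> exists2 da : 'cV[R]_m, is_derive t 1 a da &
     forall i, 0 <= da i 0} ->
  abs_continuous 0 T (sign_integral s sigma a) /\
  {ae mu, forall t, 0 < t < T -> forall da : 'cV[R]_m, is_derive t 1 a da ->
     is_derive t 1 (sign_integral s sigma a) (sign_rate s (sigma t) da)}.
Proof.
move=> /abs_continuous_colP acs /abs_continuous_colP aca aeda.
pose S i t := (diag_mx (\row_j (Num.sg (sigma t j 0) / s j)) *m a^`()%classic t) i 0.
pose P i t := (\int[mu]_(u in `[0%R, t]) S i u)%R.
have PE i : (fun t => sign_integral s sigma a t i 0) = P i.
  by apply/funext => t; rewrite mxE.
have aea i : {ae mu, forall t, 0 <= t <= T ->
    derivable (fun u => a u i 0) t 1 /\ 0 <= (fun u => a u i 0)^`()%classic t}.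
  apply: ae_interior; apply: filterS aeda => t /[apply] -[da /is_derive_colP/(_ i)].
  by move=> /is_derive1P[? ->].
have aeS i : {ae mu, forall t, 0 <= t <= T ->
    S i t = Num.sg (sigma t i 0) / s i * (fun u => a u i 0)^`()%classic t}.
  apply: ae_interior; apply: filterS aeda => t /[apply] -[da dat _].
  rewrite /S mul_diag_mx !mxE.
  have /is_derive1P[_ ->] := dat.
  by move/is_derive_colP : dat => /(_ i)/is_derive1P[_ ->].
have prim i := sign_primitive (ltW T0) (s0 i) (acs i) (aca i) (aea i) (aeS i).
split; first by apply/abs_continuous_colP => i; rewrite PE; exact: (prim i).1.
have aeP : {ae mu, forall t, forall i, 0 <= t <= T ->
    [/\ derivable (P i) t 1, (P i)^`()%classic t = S i t &
        S i t = Num.sg (sigma t i 0) / s i * (fun u => a u i 0)^`()%classic t]}.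
  apply: forall_fin_ae => i; apply: filterS2 (prim i).2 (aeS i) => t HP HS tT.
  by have [? ?] := HP tT; split => //; exact: HS.
apply: filterS aeP => t Ht /andP[t0 tT] da /is_derive_colP dat.
apply/is_derive_colP => i; rewrite PE.
have [|dP dPE SE] := Ht i; first by rewrite !ltW.
apply/is_derive1P; split => //; rewrite dPE SE mxE.
by have /is_derive1P[_ ->] := dat i.
Qed.

Let sign_integral0 (sigma a : R -> 'cV[R]_m) : sign_integral s sigma a 0 = 0.
Proof. by apply/colP => i; rewrite mxE set_itv1 Rintegral_set1 mxE. Qed.

Let apex_rates (a : R -> 'cV[R]_m) (t : R) (da : 'cV[R]_m) :
  (forall i, derivable (fun u => a u i 0) t 1 ->
    c0 i + s i * (a t - H *m a t) i 0 = 0 -> (fun u => a u i 0)^`()%classic t = 0) ->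
  is_derive t 1 a da ->
  forall i, c0 i + s i * (a t - H *m a t) i 0 = 0 -> da i 0 = 0.
Proof.
move=> apex /is_derive_colP dat i ci.
by have /is_derive1P[di <-] := dat i; exact: apex.
Qed.

(** For unrestricted increments the equality of [normal_rates_sign] can be tested on basis vectors
    and determines [p'] entirely. Both sides are then absolutely continuous with the same
    derivative. *)
Lemma lattice_plastic_strain (x eps p sigma a : R -> 'cV[R]_m)
    (zeta : R -> 'cV[R]_N) :
  lattice_problem T D Rd xi0 K H C F1 r f x eps p sigma a zeta ->
  forall t, 0 <= t <= T -> p t = p 0 + sign_integral s sigma a t.
Proof.
move=> lp; have [[_ _ acp] [acs aca _] _ _] := lp.
have rates : {ae mu, forall t, 0 < t < T -> exists dp da : 'cV[R]_m,
    [/\ is_derive t 1 p dp, is_derive t 1 a da, dp = sign_rate s (sigma t) da &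
      forall i, 0 <= da i 0]}.
  apply: filterS2 (lattice_rates lp) (apex_rest a) => t Ht apex t0T.
  have [dp [da [dpt dat rates]]] := Ht t0T; exists dp, da.
  have [] := normal_rates_sign s0 _ _ (apex_rates apex dat) rates => //.
  move=> da0 _ E; split => //; apply/colP => i.
  have := E (delta_mx i 0) I.
  by rewrite -!colE !mxE.
have [|acP dP] := sign_integral_derive acs aca.
  by apply: filterS rates => t /[apply] -[dp [da [_ dat _ da0]]]; exists da.
move=> t tT; apply/eqP; rewrite -subr_eq; apply/eqP.
rewrite (abs_continuous_col_cst_eq (b := 0) (c := T)
  (g := fun t => p t - sign_integral s sigma a t))//.
- by rewrite sign_integral0 subr0.
- by apply: abs_continuousD => //; exact: abs_continuousN.
apply: ae_interior; apply: filterS2 rates dP => u ru dPu uT.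
have [dp [da [dpu dau E _]]] := ru uT.
rewrite -(subrr dp) {2}E; apply: is_deriveD => //.
by apply: is_deriveN; exact: dPu.
Qed.

(** * From the sweeping process back to the lattice problem *)

Section FromSweeping.
Variables (x eps p sigma a y : R -> 'cV[R]_m) (zeta : R -> 'cV[R]_N).
Hypothesis sw : sweeping_solution T KK CC y a.
Hypothesis eqs : forall t, 0 <= t <= T ->
  [/\ sigma t = y t - G *m r t + F *m f t,
      eps t = invmx K *m sigma t,
      p t = p 0 + sign_integral s sigma a t,
      x t = eps t + p t
    & zeta t = pinv_compatibility D Rd *m col_mx (x t) (- (Rd *m xi0) - r t)].
Hypothesis compat0 : col_mx D Rd *m zeta 0 = col_mx (x 0) (- (Rd *m xi0) - r 0).

Let ac_y : abs_continuous 0 T y.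
Proof. by case: sw => /abs_continuous_col_mx[]. Qed.

Let ac_a : abs_continuous 0 T a.
Proof. by case: sw => /abs_continuous_col_mx[]. Qed.

Let ac_sigma : abs_continuous 0 T sigma.
Proof.
apply: (@eq_abs_continuous _ _ 0 T (fun t => y t - G *m r t + F *m f t)).
  by move=> t /eqs[].
apply: abs_continuousD; last exact: abs_continuous_mulmx.
by apply: abs_continuousD => //; apply: abs_continuousN; exact: abs_continuous_mulmx.
Qed.

(** Normality in [space_V] identifies [- K^-1 y'] with the sign rate on that space only. This gives
    the last item, while [sign_normal_rates] restores normality for all increments. *)
Let rates : {ae mu, forall t, 0 < t < T -> exists dy da : 'cV[R]_m,
  [/\ is_derive t 1 y dy /\ is_derive t 1 a da, space_V D Rd (y t),
      normal_rates s c0 setT (sign_rate s (sigma t) da) da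
        (sigma t) (a t - H *m a t),
      (forall i, 0 <= da i 0)
    & PV *m (dy + K *m sign_rate s (sigma t) da) = 0]}.
Proof.
case: sw => _; apply: filterS2 (apex_rest a) => t apex Ht /andP[t0 tT].
have {t0 tT} tT : 0 <= t <= T by rewrite !ltW.
have [dz] := Ht tT.
set z' := _^`()%classic t; rewrite -[z']vsubmxK => /CC_coneP[Vy].
have : is_derive t 1 (fun u => col_mx (y u) (a u)) z'.
  by apply/is_derive1P; split.
rewrite -[z']vsubmxK => /is_derive_col_mx[dyt dat].
have [sE _ _ _ _] := eqs tT.
have -> : y t - (G *m r t - F *m f t) = sigma t by rewrite sE opprB addrA addrAC.
rewrite col_mxKu col_mxKd => nr; exists (usubmx z'), (dsubmx z').
have [da0 act E] := normal_rates_sign s0 (fun c v => @space_VZ c v) space_V0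
  (apex_rates apex dat) nr.
split => //.
  by apply: sign_normal_rates => //; case: nr.
rewrite -PVE (proj_coef_eq0 (k := k)) ?mulmx0//.
set w := sign_rate _ _ _ in E *; set dy := usubmx z' in E *.
rewrite -mulmxA mulmxDr mulKmx//; apply: mulmx_tr_eq0.
(* Testing with [V] applied to the vector itself turns its squared norm into the difference of the
   two sides of [E]. *)
rewrite trmx_mul trmxK -mulmxA; set v := V *m _.
have := E v (memV _); rewrite linearN/= mulNmx mxE => Ev.
rewrite linearD/= mulmxDl; apply/matrixP => i j; rewrite !ord1 mxE -Ev.
by rewrite subrr mxE.
Qed.

(** The process places [y] in [space_V] only almost everywhere. The residual is zero there, so its
    derivative vanishes almost everywhere by [derive1_level_set]; it is constant, and zero at some
    time. *)
Let y_space_V t : 0 <= t <= T -> PV *m y t = y t.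
Proof.
have ac_e : abs_continuous 0 T (fun t => y t + - (PV *m y t)).
  by apply: abs_continuousD => //; apply: abs_continuousN; exact: abs_continuous_mulmx.
have fix_e u : space_V D Rd (y u) -> y u + - (PV *m y u) = 0.
  by move=> Vy; rewrite -PVE (proj_V_id k0 bV Vy) subrr.
have de : {ae mu, forall t, 0 <= t <= T ->
    is_derive t 1 (fun t => y t + - (PV *m y t)) 0}.
  have lvl : {ae mu, forall t, forall i : 'I_m,
      derivable (fun u => (y u + - (PV *m y u)) i 0) t 1 ->
      (y t + - (PV *m y t)) i 0 = 0 ->
      (fun u => (y u + - (PV *m y u)) i 0)^`()%classic t = 0}.
    by apply: forall_fin_ae => i; exact: derive1_level_set.
  apply: ae_interior; apply: filterS2 rates lvl => u ru lu uT.
  have [dy [da [[dyu _] Vy _ _ _]]] := ru uT.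
  have deu : is_derive u 1 (fun t => y t + - (PV *m y t)) (dy + - (PV *m dy)).
    by apply: is_deriveD; apply: is_deriveN; exact: is_derive_mulmx.
  apply/is_derive_colP => i; apply/is_derive1P.
  have /is_derive_colP/(_ i)/is_derive1P[di _] := deu.
  by split => //; rewrite lu ?fix_e// !mxE.
have cst_e := abs_continuous_col_cst_eq ac_e de.
have [u uT Vyu] : exists2 u, 0 <= u <= T & space_V D Rd (y u).
  apply: ae_itv_exists => //; apply: ae_interior; apply: filterS rates => u.
  by move=> /[apply] -[? [? [_]]].
move=> tT; apply/esym/eqP; rewrite -subr_eq0; apply/eqP.
by rewrite cst_e// -(cst_e u)// fix_e.
Qed.

Let sign_integral_sweeping : abs_continuous 0 T (sign_integral s sigma a) /\
  {ae mu, forall t, 0 < t < T -> forall da : 'cV[R]_m, is_derive t 1 a da ->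
     is_derive t 1 (sign_integral s sigma a) (sign_rate s (sigma t) da)}.
Proof.
apply: sign_integral_derive => //.
by apply: filterS rates => t /[apply] -[dy [da [[_ dat] _ _ da0 _]]]; exists da.
Qed.

Let ac_p : abs_continuous 0 T p.
Proof.
apply: (@eq_abs_continuous _ _ 0 T (fun t => p 0 + sign_integral s sigma a t)).
  by move=> t /eqs[].
by apply: abs_continuousD; [exact: abs_continuous_cst|exact: sign_integral_sweeping.1].
Qed.

Let p_derive : {ae mu, forall t, 0 < t < T -> forall da : 'cV[R]_m,
  is_derive t 1 a da -> is_derive t 1 p (sign_rate s (sigma t) da)}.
Proof.
apply: filterS sign_integral_sweeping.2 => t Ht tT da dat.
apply: (@is_derive_eq_itv _ _ (fun t => p 0 + sign_integral s sigma a t) p 0 T) => //.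
  by move=> u /eqs[].
rewrite -[sign_rate _ _ _]add0r; apply: is_deriveD.
exact: Ht.
Qed.

Let proj_cst t : 0 <= t <= T -> PV *m (y t + K *m p t) = PV *m (y 0 + K *m p 0).
Proof.
move=> tT; apply: (abs_continuous_col_cst_eq (b := 0) (c := T)
  (g := fun t => PV *m (y t + K *m p t))) => //.
  by apply/abs_continuous_mulmx/abs_continuousD => //; exact: abs_continuous_mulmx.
apply: ae_interior; apply: filterS2 rates p_derive => u ru pu uT.
have [dy [da [[dyu dau] _ _ _ <-]]] := ru uT.
apply: is_derive_mulmx; apply: is_deriveD => //.
by apply: is_derive_mulmx; exact: pu.
Qed.

(** Rewrites the conserved quantity of [proj_cst] as the left-hand side of [compatibleP]: [PV] fixes
    [y] and [G r] and annihilates [F f]. *)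
Let proj_yE t : 0 <= t <= T ->
  PV *m (y t + K *m p t) = PV *m sigma t + PV *m (K *m p t) + G *m r t.
Proof.
move=> tT; have [-> _ _ _ _] := eqs tT.
rewrite !mulmxDr mulmxN y_space_V//.
have -> : PV *m (F *m f t) = 0.
  rewrite (_ : F *m f t = PU *m (F1 *m f t)); last by rewrite [RHS]mulmxA.
  by rewrite -PVE -PUE; apply: (proj_V_U k0 bV).
have -> : PV *m (G *m r t) = G *m r t.
  by rewrite -PVE; apply: (proj_V_id k0 bV); rewrite /G -!mulmxA; exact: memV.
by rewrite addr0 addrAC subrK.
Qed.

(** Compatibility at time 0 propagates, being equivalent to a prescribed value of a conserved
    quantity. *)
Let compat t : 0 <= t <= T -> D *m zeta t = x t /\ Rd *m (xi0 + zeta t) + r t = 0.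
Proof.
have T00 : 0 <= (0 : R) <= T by rewrite lexx ltW.
have c0t : exists z : 'cV[R]_N,
    D *m z = invmx K *m sigma 0 + p 0 /\ Rd *m (xi0 + z) + r 0 = 0.
  exists (zeta 0); have [_ <- _ <- _] := eqs T00.
  move: compat0; rewrite mul_col_mx => /eq_col_mx[-> Rz]; split => //.
  by rewrite mulmxDr Rz addrA subrr sub0r addNr.
move=> tT; have [z] : exists z : 'cV[R]_N,
    D *m z = invmx K *m sigma t + p t /\ Rd *m (xi0 + z) + r t = 0.
  apply/(compatibleP k0 rRd bU bV); rewrite !PVE -proj_yE// proj_cst// proj_yE//.
  by rewrite -!PVE; apply/(compatibleP k0 rRd bU bV).
have [_ <- _ <- ->] := eqs tT; move=> [Dz Rz].
(* The system has a solution [z], which the pseudoinverse recovers exactly. *)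
suff -> : pinv_compatibility D Rd *m col_mx (x t) (- (Rd *m xi0) - r t) = z by [].
move: Rz; rewrite mulmxDr => /eqP; rewrite addr_eq0 => /eqP <-.
by rewrite addKr -Dz pinv_compatibilityK.
Qed.

Lemma sweeping_lattice :
  lattice_problem T D Rd xi0 K H C F1 r f x eps p sigma a zeta.
Proof.
have ac_eps : abs_continuous 0 T eps.
  apply: (@eq_abs_continuous _ _ 0 T (fun t => invmx K *m sigma t)).
    by move=> t /eqs[].
  exact: abs_continuous_mulmx.
have ac_x : abs_continuous 0 T x.
  apply: (@eq_abs_continuous _ _ 0 T (fun t => eps t + p t)).
    by move=> t /eqs[].
  exact: abs_continuousD.
have ac_zeta : abs_continuous 0 T zeta.
  apply: (@eq_abs_continuous _ _ 0 T (fun t => pinv_compatibility D Rd *m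
    col_mx (x t) (- (Rd *m xi0) - r t))); first by move=> t /eqs[].
  apply/abs_continuous_mulmx/abs_continuous_col_mx; split => //.
  by apply: abs_continuousD; [exact: abs_continuous_cst|exact: abs_continuousN].
split => //.
- move=> t tT; have [sE eE _ xE _] := eqs tT; have [Dz Rz] := compat tT.
  split => //; first by rewrite eE mulKVmx.
  rewrite stress_balanceE sE opprD opprB.
  (* Both groups lie in [space_V]: the first is a residual of the projection [PU], the second
     combines columns of [V]. *)
  have -> : F1 *m f t + (G *m r t - y t - F *m f t) =
      (F1 *m f t - PU *m (F1 *m f t)) + (G *m r t - y t).
    by rewrite addrCA addrC (mulmxA PU).
  apply: space_VD; first by rewrite -PUE; exact: (proj_U_compl k0 rRd bU).
  apply: space_VD; first by rewrite /G -!mulmxA; exact: memV.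
  by apply: space_VN; rewrite -y_space_V// -PVE; exact: memV.
apply: ae_interior; apply: filterS2 rates p_derive => t Ht pt t0T.
have [dy [da [[_ dat] _ nr _ _]]] := Ht t0T.
have /is_derive1P[dz ->] : is_derive t 1 (fun u => col_mx (p u) (- a u))
    (col_mx (sign_rate s (sigma t) da) (- da)).
  by apply/is_derive_col_mx; split; [exact: pt|exact: is_deriveN].
by split => //; apply/lattice_normal_coneP.
Qed.

End FromSweeping.
Lemma lattice_sweeping_equiv (x eps p sigma a y : R -> 'cV[R]_m)
    (zeta : R -> 'cV[R]_N) :
  (lattice_problem T D Rd xi0 K H C F1 r f x eps p sigma a zeta /\
   forall t, 0 <= t <= T -> y t = sigma t + G *m r t - F *m f t) <->
  [/\ sweeping_solution T KK CC y a,
      (forall t, 0 <= t <= T ->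
        [/\ sigma t = y t - G *m r t + F *m f t,
            eps t = invmx K *m sigma t,
            p t = p 0 + sign_integral s sigma a t,
            x t = eps t + p t
          & zeta t = pinv_compatibility D Rd
                       *m col_mx (x t) (- (Rd *m xi0) - r t)])
    & col_mx D Rd *m zeta 0 = col_mx (x 0) (- (Rd *m xi0) - r 0)].
Proof.
split=> [[lp yE]|[sw eqs compat0]]; last first.
  split; first exact: sweeping_lattice sw eqs compat0.
  by move=> t tT; have [-> _ _ _ _] := eqs t tT; rewrite addrAC addrK subrK.
have [_ _ eqs _] := lp.
have Rz t : 0 <= t <= T -> Rd *m zeta t = - (Rd *m xi0) - r t.
  move=> tT; have [_ _ _ + _] := eqs t tT.
  rewrite mulmxDr => /eqP; rewrite addr_eq0 => /eqP <-.
  by rewrite addKr.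
split; first exact: lattice_sweeping lp yE.
- move=> t tT; have [xE sE Dz _ _] := eqs t tT; split => //.
  + by rewrite yE// addrAC subrK addrK.
  + by rewrite sE mulKmx.
  + exact: lattice_plastic_strain lp _ tT.
  + by rewrite -Rz// -Dz pinv_compatibilityK.
- have T00 : 0 <= (0 : R) <= T by rewrite lexx ltW.
  have [_ _ Dz _ _] := eqs 0 T00.
  by rewrite mul_col_mx Rz// Dz.
Qed.

End PositiveHardening.
End Equivalence.

Theorem theorem4p1 (R : realType) (d n m q : nat) (T : R)
    (orig term : 'I_m -> 'I_n) (xi0 : 'cV[R]_(n * d))
    (Rd : 'M[R]_(q, n * d)) (r : R -> 'cV[R]_q) (f : R -> 'cV[R]_(n * d))
    (k h s c0 : 'I_m -> R)
    (dimU dimV : nat) (U : 'M[R]_(m, dimU)) (V : 'M[R]_(m, dimV)) :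
  let phi := length_map (incidence_mx R orig term) in
  let D := jacobi_mx phi xi0 in
  let K := diag_mx (\row_i k i) in
  let H := diag_mx (\row_i h i) in
  let C := elastic_set c0 s in
  let F1 := usubmx (pinv_equilibrium D Rd) in
  let G := V *m proj_coef K V *m K *m D *m rpinv Rd in
  let F := U *m proj_coef K U *m F1 in
  let KK := block_mx K 0 0 1%:M in
  let CC := fun (t : R) (a : 'cV[R]_m) =>
    translate C (col_mx (G *m r t - F *m f t) (H *m a))
    `&` [set z | space_V D Rd (usubmx z)] in
  let statement_i := fun (x eps p sigma a y : R -> 'cV[R]_m)
      (zeta : R -> 'cV[R]_(n * d)) =>
    lattice_problem T D Rd xi0 K H C F1 r f x eps p sigma a zeta
    /\ forall t, 0 <= t <= T -> y t = sigma t + G *m r t - F *m f t in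
  let statement_ii := fun (x eps p sigma a y : R -> 'cV[R]_m)
      (zeta : R -> 'cV[R]_(n * d)) =>
    [/\ sweeping_solution T KK CC y a,
        (forall t, 0 <= t <= T ->
          [/\ sigma t = y t - G *m r t + F *m f t,
              eps t = invmx K *m sigma t,
              p t = p 0 + sign_integral s sigma a t,
              x t = eps t + p t
            & zeta t = pinv_compatibility D Rd
                         *m col_mx (x t) (- (Rd *m xi0) - r t)])
      & col_mx D Rd *m zeta 0 = col_mx (x 0) (- (Rd *m xi0) - r 0)] in
  0 < T ->
  (forall i, phi xi0 i 0 != 0) ->
  (forall i, 0 < k i) -> (forall i, 0 <= s i) -> (forall i, 0 < c0 i) ->
  is_basis_of U (space_U K D Rd) -> is_basis_of V (space_V D Rd) ->
  \rank Rd = q ->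
  (forall w : 'cV[R]_(n * d), D *m w = 0 -> Rd *m w = 0 -> w = 0) ->
  abs_continuous 0 T r -> abs_continuous 0 T f ->
  (n * d < m + q)%N ->
  ((forall i, 0 < s i) ->
    forall x eps p sigma a y zeta,
      statement_i x eps p sigma a y zeta <-> statement_ii x eps p sigma a y zeta)
  /\
  ((exists i, s i = 0) ->
    forall x eps p sigma a y zeta,
      statement_i x eps p sigma a y zeta -> sweeping_solution T KK CC y a).
Proof.
move=> phi D K H C F1 G F KK CC statement_i statement_ii T0 _ k0 s0 c00 bU bV rRd
  kerDR acr acf _.
split=> [sp|_] x eps p sigma a y zeta; first exact: lattice_sweeping_equiv.
by move=> [lp yE]; exact: lattice_sweeping lp yE.
Qed.
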